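(* Let $n \ge 1$ and let $\equiv$ be a simple essential lattice congruence of the weak order on $\mathfrak{S}_n$. Then the Hasse diagram of any $\equiv$-poset is a separating tree.
   Context: Notation: $[n]=\{1,\dots,n\}$ and $]i,j[\,=\{i+1,\dots,j-1\}$ for $i<j$. The weak order on the permutations $\mathfrak{S}_n$ of $[n]$ is the lattice defined by $\sigma\le\tau$ iff $\mathrm{inv}(\sigma)\subseteq\mathrm{inv}(\tau)$, where $\mathrm{inv}(\sigma)=\{(\sigma_p,\sigma_q) : p<q,\ \sigma_p>\sigma_q\}$. A lattice congruence is an equivalence relation $\equiv$ on $\mathfrak{S}_n$ compatible with meets and joins; its classes are intervals. Arcs. An arc is a quadruple $(i,j,A,B)$ with $1\le i<j\le n$ and $A\sqcup B={]i,j[}$; $\mathcal{A}_n$ is the set of all arcs. The up arc is $u(i,j)=(i,j,]i,j[,\varnothing)$ and the down arc is $d(i,j)=(i,j,\varnothing,]i,j[)$. The arc $(i,j,A,B)$ is a subarc of $(i',j',A',B')$ if $i'\le i<j\le j'$, $A\subseteq A'$ and $B\subseteq B'$. For an arc $\alpha=(i,j,A,B)$ let $\sigma_\alpha$ be the permutation with a single descent whose one-line notation is $1,\dots,i-1$, then the elements of $A$ in increasing order, then $j$, then $i$, then the elements of $B$ in increasing order, then $j+1,\dots,n$. For a lattice congruence $\equiv$, let $\mathcal{A}_\equiv$ be the set of arcs $\alpha$ such that $\sigma_\alpha$ is the minimum of its $\equiv$-class. (The map $\equiv\ \mapsto\mathcal{A}_\equiv$ is a bijection from the lattice congruences of the weak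 order on $\mathfrak{S}_n$ to the subsets of $\mathcal{A}_n$ closed under taking subarcs.) The congruence $\equiv$ is essential if $\mathcal{A}_\equiv$ contains all arcs $(i,i+1,\varnothing,\varnothing)$, $i\in[n-1]$. It is simple if every arc of $\mathcal{A}_n\setminus\mathcal{A}_\equiv$ having no strict subarc in $\mathcal{A}_n\setminus\mathcal{A}_\equiv$ is an up arc or a down arc. $\equiv$-posets. A linear extension of a poset $\preccurlyeq$ on $[n]$ is a permutation $\sigma\in\mathfrak{S}_n$ such that $i\preccurlyeq j$ implies $\sigma^{-1}(i)\le\sigma^{-1}(j)$. Each $\equiv$-class is the set of all linear extensions of a unique poset on $[n]$; the posets obtained this way are the $\equiv$-posets. The Hasse diagram of a poset is the directed graph with an edge $i\to j$ for each cover relation $i\prec j$. Separating trees. In a directed tree $T$ (an orientation of a tree), the parents (resp. children) of a node $j$ are the targets of its outgoing edges (resp. the sources of its incoming edges), and the ancestor (resp. descendant) subtrees of $j$ are the connected components of $T\setminus j$ containing its parents (resp. children). A separating tree is a directed tree on $[n]$ in which each node has at most two parents and at most two children, and whenever a node $j$ has two parents (resp. two children), all nodes of one of its two ancestor (resp. descendant) subtrees are smaller than $j$ and all nodes of the other one are larger than $j$. *)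

(* Defs.v *)
(* The ground set [n] = {1, ..., n} is represented by
   'I_n = {0, ..., n-1}, i.e. all labels are shifted by one. *)
From HB Require Import structures.
From mathcomp Require Import all_boot all_fingroup.

Set Implicit Arguments.
Unset Strict Implicit.
Unset Printing Implicit Defensive.

(* A permutation s : 'S_n has one-line notation s 0, s 1, ..., s (n-1):
   s p is the value at position p, and s^-1 v the position of the value v. *)

Definition inv_set n (s : 'S_n) : {set 'I_n * 'I_n} :=
  [set (s pq.1, s pq.2) | pq : 'I_n * 'I_n & (pq.1 < pq.2) && (s pq.2 < s pq.1)].

Definition weak_le n (s t : 'S_n) : bool := inv_set s \subset inv_set t.

Definition is_meet n (s t m : 'S_n) : Prop :=
  [/\ weak_le m s, weak_le m t
    & forall r, weak_le r s -> weak_le r t -> weak_le r m].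

Definition is_join n (s t m : 'S_n) : Prop :=
  [/\ weak_le s m, weak_le t m
    & forall r, weak_le s r -> weak_le t r -> weak_le m r].

(* Meets and joins are unique by antisymmetry, so compatibility can be stated
   with the relations is_meet and is_join rather than with operations. *)
Definition lattice_congruence n (R : rel 'S_n) : Prop :=
  [/\ equivalence_rel R,
      forall s s' t t' m m', R s s' -> R t t' ->
        is_meet s t m -> is_meet s' t' m' -> R m m'
    & forall s s' t t' m m', R s s' -> R t t' ->
        is_join s t m -> is_join s' t' m' -> R m m'].

Definition open_int n (i j : 'I_n) : {set 'I_n} := [set k : 'I_n | i < k < j].

Definition is_arc n (a : 'I_n * 'I_n * {set 'I_n} * {set 'I_n}) : bool :=
  let: (i, j, A, B) := a in
  [&& i < j, A :|: B == open_int i j & [disjoint A & B]].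

Record arc n := Arc {
  arc_val :> 'I_n * 'I_n * {set 'I_n} * {set 'I_n};
  arcP : is_arc arc_val }.

HB.instance Definition _ n := [isSub for @arc_val n].
HB.instance Definition _ n := [Finite of arc n by <:].

Definition arc_lo n (a : arc n) : 'I_n := a.1.1.1.
Definition arc_hi n (a : arc n) : 'I_n := a.1.1.2.
Definition arc_A n (a : arc n) : {set 'I_n} := a.1.2.
Definition arc_B n (a : arc n) : {set 'I_n} := a.2.

Definition up_arc n (a : arc n) : bool :=
  (arc_A a == open_int (arc_lo a) (arc_hi a)) && (arc_B a == set0).

Definition down_arc n (a : arc n) : bool :=
  (arc_A a == set0) && (arc_B a == open_int (arc_lo a) (arc_hi a)).

Definition subarc n (a b : arc n) : bool :=
  [&& arc_lo b <= arc_lo a, arc_hi a <= arc_hi b,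
      arc_A a \subset arc_A b & arc_B a \subset arc_B b].

Definition strict_subarc n (a b : arc n) : bool := subarc a b && (a != b).

(* enum lists a subset of 'I_n in increasing order. *)
Definition arc_word n (a : arc n) : seq 'I_n :=
  enum [set k : 'I_n | k < arc_lo a] ++ enum (arc_A a) ++
  arc_hi a :: arc_lo a :: enum (arc_B a) ++
  enum [set k : 'I_n | arc_hi a < k].

Lemma arc_word_count n (a : arc n) (k : 'I_n) : count_mem k (arc_word a) = 1.
Proof.
case: a => [[[[i j] A] B]] aP; rewrite /arc_word /arc_lo /arc_hi /arc_A /arc_B /=.
have /and3P[ltij /eqP eqAB dAB] := aP.
have kAB : (k \in A) || (k \in B) = (i < k < j).
  by have /setP/(_ k) := eqAB; rewrite !inE.
have kD : ~~ ((k \in A) && (k \in B)).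
  apply/negP => /andP[kA kB].
  by have := disjointFr dAB kA; rewrite kB.
rewrite !(count_cat, count_uniq_mem _ (enum_uniq _), mem_enum, inE) /=.
rewrite !(count_cat, count_uniq_mem _ (enum_uniq _), mem_enum, inE) /=.
rewrite -[j == k]/(nat_of_ord j == k) -[i == k]/(nat_of_ord i == k).
move: kAB kD ltij; case: (k \in A); case: (k \in B) => //= /esym;
  case: (ltngtP i k) => [ik|ki|ik]; case: (ltngtP k j) => [kj|jk|kj] //= _ _ ij.
- by have := ltn_trans ij (ltn_trans jk ki); rewrite ltnn.
- by move: ij; rewrite -kj => /(ltn_trans ki); rewrite ltnn.
- by move: ij; rewrite ik => /(ltn_trans jk); rewrite ltnn.
- by move: ij; rewrite ik kj ltnn.
Qed.

Lemma arc_word_perm n (a : arc n) : perm_eq (arc_word a) (enum 'I_n).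
Proof.
apply/allP => k _ /=.
by rewrite arc_word_count count_uniq_mem ?enum_uniq // mem_enum.
Qed.

Lemma size_arc_word n (a : arc n) : size (arc_word a) = n.
Proof. by rewrite (perm_size (arc_word_perm a)) size_enum_ord. Qed.

Definition arc_fun n (a : arc n) (p : 'I_n) : 'I_n := nth p (arc_word a) p.

Lemma arc_fun_inj n (a : arc n) : injective (arc_fun a).
Proof.
move=> p q; rewrite /arc_fun (set_nth_default p q) ?size_arc_word //.
move=> /eqP; rewrite nth_uniq ?size_arc_word //; first by move/eqP/val_inj.
by rewrite (perm_uniq (arc_word_perm a)) enum_uniq.
Qed.

(* The permutation sigma_a with one-line notation arc_word a. *)
Definition arc_perm n (a : arc n) : 'S_n := perm (@arc_fun_inj n a).

Lemma arc_permE n (a : arc n) : [seq arc_perm a p | p <- enum 'I_n] = arc_word a.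
Proof.
case: n a => [|n] a; first by case: (arc_lo a).
apply: (@eq_from_nth _ ord0); rewrite size_map size_enum_ord ?size_arc_word //.
move=> p ltp; rewrite (nth_map ord0) ?size_enum_ord // permE /arc_fun.
by rewrite nth_enum_ord //; apply: set_nth_default; rewrite size_arc_word.
Qed.

Definition arcs_of n (R : rel 'S_n) : {set arc n} :=
  [set a | [forall t, R (arc_perm a) t ==> weak_le (arc_perm a) t]].

Definition essential n (R : rel 'S_n) : Prop :=
  forall a : arc n, arc_hi a = (arc_lo a).+1 :> nat ->
    arc_A a = set0 -> arc_B a = set0 -> a \in arcs_of R.

Definition simple_congruence n (R : rel 'S_n) : Prop :=
  forall a : arc n, a \notin arcs_of R ->
    (forall b, strict_subarc b a -> b \in arcs_of R) ->
    up_arc a || down_arc a.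

Definition poset n (P : rel 'I_n) : Prop :=
  [/\ reflexive P, antisymmetric P & transitive P].

Definition linear_extension n (P : rel 'I_n) (s : 'S_n) : Prop :=
  forall i j, P i j -> (s^-1)%g i <= (s^-1)%g j.

Definition congruence_poset n (R : rel 'S_n) (P : rel 'I_n) : Prop :=
  poset P /\ exists s : 'S_n, forall t, R s t <-> linear_extension P t.

Definition hasse n (P : rel 'I_n) : rel 'I_n :=
  fun i j => [&& P i j, i != j &
    [forall k, P i k && P k j ==> (k == i) || (k == j)]].

Section DirectedTrees.

Variables (T : finType) (e : rel T).

Definition undirected : rel T := fun x y => e x y || e y x.

Definition is_tree (g : rel T) : Prop :=
  [/\ 0 < #|T|, forall x y, connect g x y
    & forall c : seq T, ucycle g c -> size c <= 2].

Definition directed_tree : Prop :=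
  (forall x y, e x y -> ~~ e y x) /\ is_tree undirected.

Definition parents (j : T) : {set T} := [set k | e j k].
Definition children (j : T) : {set T} := [set k | e k j].

Definition remove_node (j : T) : rel T :=
  fun x y => [&& x != j, y != j & undirected x y].

(* The connected component of k in the graph minus j, for k != j. *)
Definition component (j k : T) : {set T} := [set x | connect (remove_node j) k x].

Definition ancestor_subtrees (j : T) : {set {set T}} :=
  [set component j k | k in parents j].
Definition descendant_subtrees (j : T) : {set {set T}} :=
  [set component j k | k in children j].

End DirectedTrees.

Definition separated n (j : 'I_n) (S : {set {set 'I_n}}) : Prop :=
  exists X Y : {set 'I_n},
    [/\ S = [set X; Y], forall x, x \in X -> x < j & forall y, y \in Y -> j < y].

Definition separating_tree n (e : rel 'I_n) : Prop :=
  directed_tree e /\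
  forall j : 'I_n,
    [/\ #|parents e j| <= 2, #|children e j| <= 2,
        #|parents e j| = 2 -> separated j (ancestor_subtrees e j)
      & #|children e j| = 2 -> separated j (descendant_subtrees e j)].

(* Main.v *)
Require Import Defs.
From mathcomp Require Import all_boot all_fingroup.
From mathcomp Require Import zify.
(* The path library also defines a notion named arc, which must be shadowed. *)
Import Defs.

Set Implicit Arguments.
Unset Strict Implicit.
Unset Printing Implicit Defensive.

(** Call an arc contracted when it is not in [arcs_of R].  Swapping two
    adjacent values [i < j] of a permutation stays in the same class exactly
    when the arc recording [i], [j] and the values of [ ]i,j[ placed before
    (resp. after) them is contracted ([swapped_contracted]), and an arc with a
    contracted subarc is contracted ([subarc_contracted]).

    Let [P] be the poset of a class.  Its linear extensions are the class, so
    two adjacent values of an extension are comparable exactly when their arc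
    is not contracted.  With essentiality this makes [k] and [k+1] always
    comparable, hence the Hasse diagram connected.  With simplicity, an
    incomparable pair [x < y] has inside [[x,y]] a contracted up arc whose
    interior precedes [x] and [y], or a contracted down arc whose interior
    follows them; conversely such an arc forbids a cover relation to pass over
    it.  The record [wall_system] collects these facts; it is invariant under
    reversing [P] and exchanging up and down arcs, so children are handled as
    the parents of the opposite poset.

    From there the proof is about [P] alone.  Two upper covers of [j] lie on
    opposite sides of [j] ([covers_opposite]).  If [j] has two upper covers,
    then the contracted arc given by their incomparability is an up arc
    passing over [j] whose whole interior lies weakly below [j]
    ([wall_exists], by induction along [P]).  It acts as a wall erected above
    [j]: a cover relation [u -> v] with [j] strictly between [u] and [v] must
    start below [j] ([wall_cover]).

    A cycle of the Hasse diagram is then impossible: at a [P]-minimal vertex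
    [j] both neighbours on the cycle are upper covers, on opposite sides of
    [j], so the rest of the cycle jumps over [j], starting from a vertex below
    [j] ([hasse_acyclic]).  Likewise a path in the diagram minus [j] starting
    at a parent of [j] and changing side would meet an element below [j], and
    going back up to [j] would close a cycle ([ancestors_side]). *)

(** * Permutations as total orders, and meets in the weak order *)

(** All permutations below are handled through the order in which they list
    the values; inversions are the pairs on which it disagrees with [<]. *)
Definition before n (s : 'S_n) : rel 'I_n := fun a b => (s^-1)%g a < (s^-1)%g b.

Lemma before_total n (s : 'S_n) a b : a != b -> before s a b || before s b a.
Proof.
move=> ab; rewrite /before -neq_ltn; apply: contra ab => /eqP e.
by apply/eqP/(@perm_inj _ (s^-1)%g)/val_inj.
Qed.

Lemma beforeC n (s : 'S_n) a b : a != b -> before s a b = ~~ before s b a.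
Proof. by move=> /(before_total s); rewrite /before; lia. Qed.

Lemma before_trans n (s : 'S_n) : transitive (before s).
Proof. by move=> b a c; apply: ltn_trans. Qed.

Lemma mem_inv n (s : 'S_n) a b : ((b, a) \in inv_set s) = (a < b) && before s b a.
Proof.
rewrite /inv_set /before; apply/imsetP/andP => [[[p q] /=]|[ab sba]].
  by rewrite inE /= => /andP[pq sqp] [-> ->]; rewrite !permK.
by exists ((s^-1)%g b, (s^-1)%g a); rewrite ?inE /= !permKV ?sba.
Qed.

Lemma weak_leP n (s t : 'S_n) :
  reflect (forall a b : 'I_n, a < b -> before s b a -> before t b a) (weak_le s t).
Proof.
apply: (iffP subsetP) => st.
  by move=> a b ab sba; have := st (b, a); rewrite !mem_inv ab /=; apply.
by move=> [b a]; rewrite !mem_inv => /andP[ab /(st _ _ ab) ->]; rewrite ab.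
Qed.

Lemma weak_le_refl n (s : 'S_n) : weak_le s s.
Proof. exact: subxx. Qed.

Lemma weak_le_trans n (s t r : 'S_n) : weak_le s t -> weak_le t r -> weak_le s r.
Proof. exact: subset_trans. Qed.

(** The position of [a] is the number of values preceding it, which recovers
    the order since that order is total. *)
Lemma perm_of_order n (L : rel 'I_n) :
  irreflexive L -> transitive L -> (forall a b, a != b -> L a b || L b a) ->
  exists s : 'S_n, before s =2 L.
Proof.
move=> Li Lt Ltot; pose rk a := #|[set k | L k a]|.
have rk_lt a b : L a b -> rk a < rk b.
  move=> ab; apply/proper_card/properP; split.
    by apply/subsetP => k; rewrite !inE => /Lt; apply.
  by exists a; rewrite inE ?Li.
have rkn a : rk a < n.
  rewrite -[X in _ < X]card_ord -cardsT; apply/proper_card/properP; split=> //.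
  by exists a; rewrite inE ?Li.
have rk_inj : injective (fun a => Ordinal (rkn a)).
  move=> a b [] e; apply/eqP/negPn/negP => /Ltot /orP[] /rk_lt; rewrite e; lia.
exists ((perm rk_inj)^-1)%g => a b; rewrite /before invgK !permE /=.
case: (eqVneq a b) => [->|ab]; first by rewrite Li ltnn.
case Lab: (L a b); first exact: rk_lt.
by have := Ltot _ _ ab; rewrite Lab /= => /rk_lt; lia.
Qed.

(** The refinement of an ordered partition into blocks by a permutation. *)
Lemma perm_of_blocks n (f : 'I_n -> nat) (s : 'S_n) :
  exists t : 'S_n, forall a b,
    before t a b = (f a < f b) || (f a == f b) && before s a b.
Proof.
apply: (@perm_of_order _ (fun a b => (f a < f b) || (f a == f b) && before s a b)).
- by move=> a; rewrite /before; lia.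
- by move=> b a c; rewrite /before; lia.
- by move=> a b /(before_total s); rewrite /before; lia.
Qed.

Lemma perm_of_key n (f : 'I_n -> nat) :
  exists t : 'S_n, forall a b : 'I_n, a < b -> before t b a = (f b < f a).
Proof.
have [t tE] := perm_of_blocks f 1%g; exists t => a b ab.
by rewrite tE /before invg1 !perm1; lia.
Qed.

(** The weak order is a lattice: a pair is inverted in the meet of [s] and [t]
    unless it is joined by an increasing chain of steps each of which is a
    non-inversion of [s] or of [t]. *)

Section Meet.
Variables (n : nat) (s t : 'S_n).
Let E : rel 'I_n := fun a b => (a < b) && (before s a b || before t a b).

(** Cotransitivity of chains: the step of the chain jumping over [c] can be cut
    at [c].  This makes the complement of the chain relation transitive. *)
Let conn_split a b (c : 'I_n) : connect E a b -> a < c < b -> connect E a c || connect E c b.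
Proof.
case/connectP => p pp ->{b}; elim: p a pp => [|d p IH] a /=; first by lia.
move=> /andP[Ead pp] /andP[ac cl].
have dl : connect E d (last d p) by apply/connectP; exists p.
case: (ltngtP c d) => [cd|dc|/val_inj ->]; last by rewrite connect1.
  have : E a c || E c d.
    move: Ead; rewrite /E ac cd => /andP[_].
    have /(before_total s) : a != c by apply: contraTneq ac => ->; rewrite ltnn.
    have /(before_total t) : a != c by apply: contraTneq ac => ->; rewrite ltnn.
    by rewrite /before; lia.
  case/orP => [/connect1 -> //|/connect1 cd'].
  by rewrite (connect_trans cd' dl) orbT.
have /orP[dc'|->] := IH d pp (introT andP (conj dc cl)); last by rewrite orbT.
by rewrite (connect_trans (connect1 Ead) dc').
Qed.

Lemma meet_exists : exists m, is_meet s t m.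
Proof.
pose L (a b : 'I_n) := (a < b) && connect E a b || (b < a) && ~~ connect E b a.
have [|b a c|a b|m mE] := @perm_of_order n L.
- by move=> a; rewrite /L ltnn.
- rewrite /L; case: (ltngtP a b) => //= ab; case: (ltngtP b c) => //= bc; rewrite ?orbF.
  + move=> cab cbc; rewrite (connect_trans cab cbc); lia.
  + move=> cab ncb; case: (ltngtP a c) => [ac|ca|/val_inj ac] /=.
    * by have := conn_split cab (introT andP (conj ac bc)); rewrite (negPf ncb) orbF => ->.
    * by rewrite ?andbF /=; apply: contra ncb => /connect_trans; apply.
    * by rewrite -ac cab in ncb.
  + move=> nba cbc; case: (ltngtP a c) => [ac|ca|/val_inj ac] /=.
    * by have := conn_split cbc (introT andP (conj ab ac)); rewrite (negPf nba) => /= ->.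
    * by rewrite ?andbF /=; apply: contra nba; apply: connect_trans.
    * by rewrite ac cbc in nba.
  + move=> nba ncb; apply/orP; right; apply/andP; split; first by lia.
    apply/negP => cca; have := conn_split cca (introT andP (conj bc ab)).
    by rewrite (negPf nba) (negPf ncb).
- rewrite -val_eqE /L /=.
  by case: ltngtP => //= ab _; rewrite ?orbF ?orbN ?orNb //; case: connect.
have mE' (a b : 'I_n) : a < b -> before m b a = ~~ connect E a b.
  by move=> ab; rewrite mE /L ab (ltnNge b) ltnW.
exists m; split.
- apply/weak_leP => a b ab; rewrite mE' //; apply: contraR => sba.
  apply: connect1; rewrite /E ab (beforeC s) ?sba //.
  by apply: contraTneq ab => ->; rewrite ltnn.
- apply/weak_leP => a b ab; rewrite mE' //; apply: contraR => sba.
  apply: connect1; rewrite /E ab (beforeC t) ?sba ?orbT //.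
  by apply: contraTneq ab => ->; rewrite ltnn.
move=> r /weak_leP rs /weak_leP rt; apply/weak_leP => a b ab rba.
rewrite mE' //; apply/negP => /connectP[p pp bE].
suff : (r^-1)%g a <= (r^-1)%g b by rewrite leqNgt -/(before r b a) rba.
rewrite bE {bE rba ab b}; elim: p a pp => //= c p IH a /andP[/andP[ac Eac] /IH].
apply: leq_trans; rewrite leqNgt; apply/negP => rca.
have sca := rs _ _ ac rca; have tca := rt _ _ ac rca.
by move: Eac sca tca; rewrite /before; lia.
Qed.
End Meet.

(** * Arcs and contraction *)

Lemma ord_ltn_neq n (a b : 'I_n) : a < b -> a != b.
Proof. by apply: contraTneq => ->; rewrite ltnn. Qed.

Lemma arc_lo_hi n (a : arc n) : arc_lo a < arc_hi a.
Proof. by case: a => [[[[i j] A] B] aP]; have /and3P[] := aP. Qed.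

Lemma arc_AB n (a : arc n) (k : 'I_n) :
  (k \in arc_A a) || (k \in arc_B a) = (arc_lo a < k < arc_hi a).
Proof.
case: a => [[[[i j] A] B] aP]; have /and3P[_ /eqP/setP/(_ k)] := aP.
by rewrite !inE.
Qed.

Lemma arc_AnB n (a : arc n) (k : 'I_n) :
  (k \in arc_B a) = (arc_lo a < k < arc_hi a) && (k \notin arc_A a).
Proof.
rewrite -arc_AB; case: a => [[[[i j] A] B] aP]; have /and3P[_ _ dAB] := aP.
rewrite /arc_A /arc_B /=; case kA : (k \in A) => /=; last by rewrite andbT.
by rewrite (disjointFr dAB kA).
Qed.

Lemma arc_A_sub n (a : arc n) (k : 'I_n) : k \in arc_A a -> arc_lo a < k < arc_hi a.
Proof. by rewrite -arc_AB => ->. Qed.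

Lemma arc_B_sub n (a : arc n) (k : 'I_n) : k \in arc_B a -> arc_lo a < k < arc_hi a.
Proof. by rewrite -arc_AB => ->; rewrite orbT. Qed.

Lemma arc_exists n (i j : 'I_n) (D : pred 'I_n) : i < j ->
  exists a : arc n, [/\ arc_lo a = i, arc_hi a = j
    & forall k : 'I_n, (k \in arc_A a) = (i < k < j) && D k].
Proof.
move=> ij; pose A := [set k in open_int i j | D k].
have aP : is_arc (i, j, A, open_int i j :\: A).
  rewrite /is_arc ij -setI_eq0 setDE setICA setICr setI0 eqxx andbT /=.
  by apply/eqP/setP => k; rewrite !inE; case: (D k); case: (i < k < j).
by exists (Arc aP); split=> // k; rewrite !inE.
Qed.

(** The blocks of [arc_word a], numbered from left to right, with the two outer
    ones merged into their neighbours: each merged block is still increasing. *)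
Definition arc_rank n (a : arc n) (k : 'I_n) : nat :=
  if k == arc_hi a then 1 else if k == arc_lo a then 2
  else if (k < arc_lo a) || (k \in arc_A a) then 0 else 3.

Lemma pairwise_enum n (S : {set 'I_n}) (L : rel 'I_n) :
  {in S &, forall x y : 'I_n, x < y -> L x y} -> pairwise L (enum S).
Proof.
move=> SL; apply: (@sub_in_pairwise _ (mem S) (relpre val ltn)).
- by move=> x y xS yS; apply: SL.
- by apply/allP => x; rewrite mem_enum.
rewrite /enum_mem -enumT; apply: pairwise_filter; rewrite -pairwise_map val_enum_ord.
by rewrite -(sorted_pairwise ltn_trans) iota_ltn_sorted.
Qed.

Lemma arc_word_sorted n (a : arc n) : pairwise
  (fun p q : 'I_n => (arc_rank a p < arc_rank a q) || (arc_rank a p == arc_rank a q) && (p < q))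
  (arc_word a).
Proof.
set L := fun _ _ => _; have lh := arc_lo_hi a.
have neq (x y : 'I_n) : x < y -> (x == y = false) * (y == x = false).
  by move=> /ord_ltn_neq xy; split; [|rewrite eq_sym]; apply: negbTE.
have rhi : arc_rank a (arc_hi a) = 1 by rewrite /arc_rank eqxx.
have rlo : arc_rank a (arc_lo a) = 2 by rewrite /arc_rank (neq _ _ lh) eqxx.
have r1 k : k \in [set k : 'I_n | k < arc_lo a] -> arc_rank a k = 0.
  by rewrite inE => kl; rewrite /arc_rank (neq _ _ kl) (neq _ _ (ltn_trans kl lh)) kl.
have rA k : k \in arc_A a -> arc_rank a k = 0.
  by move=> kA; have /andP[lk kh] := arc_A_sub kA; rewrite /arc_rank (neq _ _ lk) (neq _ _ kh) kA orbT.
have rB k : k \in arc_B a -> arc_rank a k = 3.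
  move=> kB; have /andP[lk kh] := arc_B_sub kB; rewrite /arc_rank (neq _ _ lk) (neq _ _ kh).
  by move: kB; rewrite arc_AnB => /andP[_ /negPf ->]; rewrite ltnNge ltnW.
have r2 k : k \in [set k : 'I_n | arc_hi a < k] -> arc_rank a k = 3.
  rewrite inE => hk; have lk := ltn_trans lh hk; rewrite /arc_rank (neq _ _ lk) (neq _ _ hk) ltnNge ltnW //=.
  by case: ifP => // /arc_A_sub; move: hk; clear; lia.
have Llt x y : arc_rank a x < arc_rank a y -> L x y by rewrite /L => ->.
have Leq (x y : 'I_n) c : arc_rank a x = c -> arc_rank a y = c -> x < y -> L x y.
  by rewrite /L => -> -> ->; rewrite eqxx orbT.
have lE k : k \in enum [set k : 'I_n | k < arc_lo a] -> k < arc_lo a.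
  by rewrite mem_enum inE.
have hE k : k \in enum [set k : 'I_n | arc_hi a < k] -> arc_hi a < k.
  by rewrite mem_enum inE.
have lE' (k : 'I_n) : k < arc_lo a -> arc_rank a k = 0 by move=> kl; apply: r1; rewrite inE.
have hE' (k : 'I_n) : arc_hi a < k -> arc_rank a k = 3 by move=> kl; apply: r2; rewrite inE.
rewrite /arc_word pairwise_cat; apply/and3P; split.
- apply/allrelP => x y /lE xl; rewrite !(mem_cat, inE, mem_enum).
  have x0 := lE' _ xl.
  case/or4P => [yA|/eqP->|/eqP->|/orP[yB|/hE' hy]].
  + by apply: (Leq _ _ 0 x0 (rA _ yA)); apply: (ltn_trans xl); have /andP[] := arc_A_sub yA.
  + by apply: Llt; rewrite x0 rhi.
  + by apply: Llt; rewrite x0 rlo.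
  + by apply: Llt; rewrite x0 rB.
  + by apply: Llt; rewrite x0 hy.
- by apply: pairwise_enum => x y; rewrite !inE => xl yl; apply: (Leq _ _ 0); apply: lE'.
rewrite pairwise_cat; apply/and3P; split.
- apply/allrelP => x y; rewrite !(mem_cat, inE, mem_enum) => /rA x0.
  case/or3P => [/eqP->|/eqP->|/orP[/rB yB|/hE' hy]]; apply: Llt; rewrite x0.
  + by rewrite rhi.
  + by rewrite rlo.
  + by rewrite yB.
  + by rewrite hy.
- by apply: pairwise_enum => x y xA yA; apply: (Leq _ _ 0); apply: rA.
rewrite !pairwise_cons /= pairwise_cat -!andbA; apply/and5P; split.
- by apply: Llt; rewrite rhi rlo.
- apply/allP => y; rewrite !(mem_cat, inE, mem_enum) => /orP[/rB yB|/hE' hy]; apply: Llt.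
    by rewrite rhi yB.
  by rewrite rhi hy.
- apply/allP => y; rewrite !(mem_cat, inE, mem_enum) => /orP[/rB yB|/hE' hy]; apply: Llt.
    by rewrite rlo yB.
  by rewrite rlo hy.
- apply/allrelP => x y; rewrite !(mem_enum, inE) => xB hy.
  apply: (Leq _ _ 3 (rB _ xB) (hE' _ hy)); apply: (ltn_trans _ hy).
  by have /andP[] := arc_B_sub xB.
apply/andP; split.
  by apply: pairwise_enum => x y xB yB; apply: (Leq _ _ 3); apply: rB.
by apply: pairwise_enum => x y; rewrite !inE => xl yl; apply: (Leq _ _ 3); apply: hE'.
Qed.

Lemma arc_perm_rank n (a : arc n) (p q : 'I_n) : before (arc_perm a) p q ->
  (arc_rank a p < arc_rank a q) || (arc_rank a p == arc_rank a q) && (p < q).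
Proof.
move=> pq; have /(pairwiseP p) := arc_word_sorted a.
have wE v : nth p (arc_word a) ((arc_perm a)^-1 v)%g = v.
  transitivity (arc_perm a ((arc_perm a)^-1 v)%g); last exact: permKV.
  by rewrite [RHS]permE /arc_fun; apply: set_nth_default; rewrite size_arc_word.
move=> /(_ ((arc_perm a)^-1 p)%g ((arc_perm a)^-1 q)%g).
by rewrite !wE !inE size_arc_word; apply.
Qed.

Lemma arc_perm_inv n (a : arc n) (p q : 'I_n) : q < p ->
  before (arc_perm a) p q =
  ((p \in arc_A a) || (p == arc_hi a)) && ((q \in arc_B a) || (q == arc_lo a)).
Proof.
move=> qp; have lh := arc_lo_hi a.
have -> : before (arc_perm a) p q = (arc_rank a p < arc_rank a q).
  apply/idP/idP => [/arc_perm_rank|rpq]; first by move: qp; clear; lia.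
  have pq : p != q by rewrite eq_sym ord_ltn_neq.
  rewrite beforeC //; apply/negP => /arc_perm_rank; move: rpq; clear; lia.
have qB := arc_AnB a q; have pA := @arc_A_sub _ a p; have qA := @arc_A_sub _ a q.
have vE (x y : 'I_n) : (x == y) = (x == y :> nat) by [].
rewrite /arc_rank !vE; move: qp lh qB pA qA; clear.
case: (p \in _); case: (q \in arc_A a); case: (q \in arc_B a); move=> qp lh qB pA qA.
all: try have {}pA := pA isT.
all: try have {}qA := qA isT.
all: move: qp lh qB pA qA; rewrite ?andbT ?andbF ?orbT ?orbF /=; clear.
all: do 6?case: ifP; lia.
Qed.

Section Contraction.
Variables (n : nat) (R : rel 'S_n).
Hypothesis Rc : lattice_congruence R.

Lemma cong_refl s : R s s.
Proof. by case: Rc => eR _ _; have [] := eR s s s. Qed.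

Lemma cong_sym s t : R s t -> R t s.
Proof.
by case: Rc => eR _ _ st; have [_ /(_ st) e] := eR s t s; rewrite -e cong_refl.
Qed.

Lemma cong_trans s t r : R s t -> R t r -> R s r.
Proof. by case: Rc => eR _ _ st; have [_ /(_ st) ->] := eR s t r. Qed.

Lemma cong_meet s s' t t' m m' : R s s' -> R t t' ->
  is_meet s t m -> is_meet s' t' m' -> R m m'.
Proof. by case: Rc => _ + _; apply. Qed.

Lemma cong_join s s' t t' m m' : R s s' -> R t t' ->
  is_join s t m -> is_join s' t' m' -> R m m'.
Proof. by case: Rc => _ _; apply. Qed.

Lemma meet_ge (s t : 'S_n) : weak_le t s -> is_meet s t t.
Proof. by move=> st; split=> //; apply: weak_le_refl. Qed.

Lemma join_ge (s t : 'S_n) : weak_le t s -> is_join s t s.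
Proof. by move=> st; split=> //; apply: weak_le_refl. Qed.

Lemma arc_perm_hi_lo (a : arc n) : before (arc_perm a) (arc_hi a) (arc_lo a).
Proof. by rewrite arc_perm_inv ?arc_lo_hi // !eqxx !orbT. Qed.

Lemma before_split (m : 'S_n) (p q k : 'I_n) :
  before m p q -> k != p -> before m p k || before m k q.
Proof.
move=> pq kp; have := before_total m kp; move: pq; rewrite /before; clear; lia.
Qed.

(** [arc_perm a] is join irreducible: its only lower cover loses the inversion
    of [arc_hi a] and [arc_lo a].  Indeed cotransitivity recovers all other
    inversions from that one, since nothing else may be inverted. *)
Lemma arc_perm_irreducible (a : arc n) (m : 'S_n) : weak_le m (arc_perm a) ->
  before m (arc_hi a) (arc_lo a) -> weak_le (arc_perm a) m.
Proof.
move=> /weak_leP mj mhl.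
have hl := arc_lo_hi a.
have sub (u v : 'I_n) : u < v -> before m v u ->
    ((v \in arc_A a) || (v == arc_hi a)) && ((u \in arc_B a) || (u == arc_lo a)).
  by move=> uv /(mj _ _ uv); rewrite arc_perm_inv.
have Alo (k : 'I_n) : k \in arc_A a -> before m k (arc_lo a).
  move=> kA; have /andP[lk kh] := arc_A_sub kA.
  have /orP[/(sub _ _ kh)|//] := before_split mhl (ord_ltn_neq kh).
  by rewrite arc_AnB kA andbF eq_sym (negPf (ord_ltn_neq lk)) andbF.
have hiB (k : 'I_n) : k \in arc_B a -> before m (arc_hi a) k.
  move=> kB; have /andP[lk kh] := arc_B_sub kB.
  have /orP[//|/(sub _ _ lk)] := before_split mhl (ord_ltn_neq kh).
  by move: kB; rewrite arc_AnB (negPf (ord_ltn_neq kh)) => /andP[_ /negPf->].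
apply/weak_leP => q p qp; rewrite arc_perm_inv //.
case/andP=> /orP[pA|/eqP->] /orP[qB|/eqP->]; auto.
have qlo : arc_lo a < q by have /andP[] := arc_B_sub qB.
have /orP[//|] := before_split (Alo p pA) (ord_ltn_neq qp).
move=> /(sub _ _ qlo) /andP[/orP[qA|/eqP qh] _].
  by move: qB; rewrite arc_AnB qA andbF.
by have := arc_B_sub qB; rewrite qh ltnn andbF.
Qed.

(** Taking meets with [arc_perm a] carries [R s t] to the class of
    [arc_perm a], which therefore contains an element not above it. *)
Lemma arc_contracted (a : arc n) (s t : 'S_n) : R s t ->
  weak_le (arc_perm a) t -> ~~ before s (arc_hi a) (arc_lo a) -> a \notin arcs_of R.
Proof.
move=> st jt ns; have [m mP] := meet_exists s (arc_perm a).
have mj := cong_meet st (cong_refl _) mP (meet_ge jt).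
rewrite inE negb_forall; apply/existsP; exists m; rewrite cong_sym //=.
apply: contra ns => /weak_leP/(_ _ _ (arc_lo_hi a) (arc_perm_hi_lo a)).
by have [/weak_leP ms _ _] := mP; apply/ms/arc_lo_hi.
Qed.

(** Conversely a contracted arc identifies [arc_perm a] with some [m] strictly
    below it.  As [s] is above all proper lower elements of [arc_perm a], joining
    with [s] sends [m] to [s] and [arc_perm a] to [t]. *)
Lemma arc_transfer (a : arc n) (s t : 'S_n) : a \notin arcs_of R ->
  (forall q p : 'I_n, q < p -> before (arc_perm a) p q ->
     (p != arc_hi a) || (q != arc_lo a) -> before s p q) ->
  is_join s (arc_perm a) t -> R s t.
Proof.
rewrite inE negb_forall => /existsP[r]; rewrite negb_imply => /andP[jr njr] js st.
have [m mP] := meet_exists (arc_perm a) r.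
have jm : R (arc_perm a) m.
  by apply: cong_meet (cong_refl _) jr _ mP; apply/meet_ge/weak_le_refl.
have [mj mr _] := mP.
have nm : ~~ before m (arc_hi a) (arc_lo a).
  by apply: contra njr => /(arc_perm_irreducible mj) /weak_le_trans; apply.
apply: cong_join (cong_refl s) (cong_sym jm) (join_ge _) st.
apply/weak_leP => q p qp mpq; apply: js => //.
  by move/weak_leP: mj; apply.
by rewrite -negb_and; apply: contra nm => /andP[/eqP <- /eqP <-].
Qed.

(** The arc of an exchange of two adjacent values, read on inversions: as [t] is
    a permutation, the last clause forces the two values to be adjacent in [s]. *)
Definition swapped (a : arc n) (s t : 'S_n) : Prop :=
  [/\ before s (arc_lo a) (arc_hi a),
      forall k, k \in arc_A a -> before s k (arc_lo a),
      forall k, k \in arc_B a -> before s (arc_hi a) k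
    & forall q p : 'I_n, q < p ->
        before t p q = before s p q || (p == arc_hi a) && (q == arc_lo a)].

Lemma swapped_contracted (a : arc n) (s t : 'S_n) : swapped a s t ->
  (a \notin arcs_of R) <-> R s t.
Proof.
case=> slh sA sB tE.
have js (q p : 'I_n) : q < p -> before (arc_perm a) p q ->
    (p != arc_hi a) || (q != arc_lo a) -> before s p q.
  move=> qp; rewrite arc_perm_inv // => /andP[/orP[pA|/eqP->] /orP[qB|/eqP->]];
    rewrite ?eqxx // => _; auto.
  exact: before_trans (before_trans (sA _ pA) slh) (sB _ qB).
have jt : weak_le (arc_perm a) t.
  apply/weak_leP => q p qp jpq; rewrite tE //.
  by case: eqP (js _ _ qp jpq) => /= _ => [|->//]; case: eqP => /= _ => [|->//]; rewrite orbT.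
split=> [aR|/arc_contracted]; last first.
  by apply=> //; rewrite beforeC ?negbK // eq_sym ord_ltn_neq // arc_lo_hi.
apply: (arc_transfer aR js); split=> //.
  by apply/weak_leP => q p qp; rewrite tE // => ->.
move=> r /weak_leP sr /weak_leP jr; apply/weak_leP => q p qp; rewrite tE //.
case/orP => [/(sr _ _ qp) //|/andP[/eqP-> /eqP->]].
exact: jr (arc_lo_hi a) (arc_perm_hi_lo a).
Qed.

(** ** Lengthening a contracted arc at one end

    The permutations listing the values [arc_lo a], [c] and [arc_hi a]
    contiguously, between the rest of [arc_A a] and the rest of [arc_B a], form
    a hexagon of the weak order.  If the arc between [c] and one end of [a] is
    contracted, two opposite edges of the hexagon are, and a join or a meet
    inside the hexagon then contracts the edge exchanging the two ends of [a]. *)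

Section Hexagon.
Variables (a : arc n) (c : 'I_n).
Hypothesis lch : arc_lo a < c < arc_hi a.
Let lo := arc_lo a.
Let hi := arc_hi a.
Let ac : lo < c. Proof. by have /andP[] := lch. Qed.
Let cd : c < hi. Proof. by have /andP[] := lch. Qed.

Definition hex_outer (k : 'I_n) : nat :=
  if (k == lo) || (k == c) || (k == hi) then 1
  else if (k < lo) || (k \in arc_A a) then 0 else 2.

Definition hex_inv (x y z : bool) (p q : 'I_n) :=
  [|| hex_outer p < hex_outer q, [&& p == c, q == lo & x],
      [&& p == hi, q == lo & y] | [&& p == hi, q == c & z]].

(** The hypotheses say that the set of inverted pairs is transitive and
    cotransitive; the six solutions are the vertices of the hexagon. *)
Lemma hex_exists x y z : x && z ==> y -> y ==> x || z ->
  exists t : 'S_n, forall q p : 'I_n, q < p -> before t p q = hex_inv x y z p q.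
Proof.
move=> xz_y y_xz.
(* The rank of [k] among [lo], [c], [hi]: the number of the other two placed
   before it. *)
pose pos (k : 'I_n) : nat := if k == lo then x + y else if k == c then ~~ x + z
  else if k == hi then ~~ y + ~~ z else 0.
have [t tE] := perm_of_key (fun k => hex_outer k * 3 + pos k).
exists t => q p qp; rewrite tE // /hex_inv.
have out k : hex_outer k != 1 -> pos k = 0 /\ [/\ k == lo = false, k == c = false & k == hi = false].
  by rewrite /hex_outer /pos; do 3![case: (k == _) => //=].
have pos2 k : pos k <= 2.
  by rewrite /pos; do 3![case: (k == _)]; case: (x); case: (y); case: (z).
have := pos2 p; have := pos2 q.
have [q1|nq1] := eqVneq (hex_outer q) 1; last first.
  have [-> [-> -> _]] := out q nq1; have [p1|np1] := eqVneq (hex_outer p) 1.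
    by move: nq1; rewrite p1 !andbF /=; clear; lia.
  by have [-> _] := out p np1; rewrite !andbF; clear; lia.
have [p1|np1] := eqVneq (hex_outer p) 1; last first.
  by have [-> [_ -> ->]] := out p np1; move: np1; rewrite q1; clear; lia.
move=> _ _; rewrite p1 q1 ltnn ltn_add2l /pos /=.
have inn k : hex_outer k = 1 -> k \in [:: lo; c; hi].
  by rewrite /hex_outer !inE; do 3![case: (k == _) => //]; case: ifP.
have nlc : (c == lo) = false by rewrite eq_sym; apply/negbTE/ord_ltn_neq.
have nlc' : (lo == c) = false by apply/negbTE/ord_ltn_neq.
have ndc : (hi == c) = false by rewrite eq_sym; apply/negbTE/ord_ltn_neq.
have nld : (hi == lo) = false by rewrite eq_sym; apply/negbTE/ord_ltn_neq/(ltn_trans ac).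
move: qp (inn _ p1) (inn _ q1); rewrite !inE => qp.
by case/or3P => /eqP pE /or3P[] /eqP qE; move: qp; rewrite pE qE ?ltnn ?eqxx ?nlc ?nlc' ?ndc ?nld
  ?(eq_sym lo) ?(eq_sym c) ?nlc ?ndc ?nld;
  move: ac cd xz_y y_xz; clear; case: x; case: y; case: z => //=; clear; lia.
Qed.

Definition hex x y z (t : 'S_n) :=
  forall q p : 'I_n, q < p -> before t p q = hex_inv x y z p q.

Let lohi : lo < hi. Proof. exact: ltn_trans ac cd. Qed.

Let out_lo : hex_outer lo = 1. Proof. by rewrite /hex_outer eqxx. Qed.
Let out_c : hex_outer c = 1. Proof. by rewrite /hex_outer eqxx orbT. Qed.
Let out_hi : hex_outer hi = 1. Proof. by rewrite /hex_outer eqxx !orbT. Qed.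

Let out_A k : k \in arc_A a -> k != c -> hex_outer k = 0.
Proof.
move=> kA kc; have /andP[lk kh] := arc_A_sub kA.
by rewrite /hex_outer (negPf kc) eq_sym !(negPf (ord_ltn_neq _)) // kA orbT.
Qed.

Let out_B k : k \in arc_B a -> k != c -> hex_outer k = 2.
Proof.
move=> kB kc; have /andP[lk kh] := arc_B_sub kB.
move: kB; rewrite arc_AnB => /andP[_ /negPf kA].
rewrite /hex_outer (negPf kc) eq_sym !(negPf (ord_ltn_neq _)) // kA orbF.
by rewrite ltnNge ltnW.
Qed.

Lemma hex_c_lo x y z t : hex x y z t -> before t c lo = x.
Proof.
by move=> ->; rewrite // /hex_inv out_c out_lo ltnn !eqxx (negPf (ord_ltn_neq cd)) /= orbF.
Qed.

Lemma hex_hi_lo x y z t : hex x y z t -> before t hi lo = y.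
Proof.
move=> ->; rewrite // /hex_inv out_hi out_lo ltnn !eqxx (negPf (ord_ltn_neq ac)) andbF orbF.
by rewrite [hi == c]eq_sym (negPf (ord_ltn_neq cd)).
Qed.

Lemma hex_hi_c x y z t : hex x y z t -> before t hi c = z.
Proof.
move=> ->; rewrite // /hex_inv out_hi out_c ltnn !eqxx [c == lo]eq_sym.
by rewrite (negPf (ord_ltn_neq ac)) !andbF.
Qed.

Lemma hex_le x y z x' y' z' s t : hex x y z s -> hex x' y' z' t ->
  x ==> x' -> y ==> y' -> z ==> z' -> weak_le s t.
Proof.
move=> sE tE xx yy zz; apply/weak_leP => q p qp; rewrite sE // tE // /hex_inv.
by case/or4P => [->//|/and3P[-> -> h]|/and3P[-> -> h]|/and3P[-> -> h]];
  rewrite ?(implyP xx h) ?(implyP yy h) ?(implyP zz h) ?orbT.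
Qed.

Lemma hex_outer_before x y z s (p q : 'I_n) : hex x y z s -> q < p ->
  hex_outer p < hex_outer q -> before s p q.
Proof. by move=> sE qp opq; rewrite sE // /hex_inv opq. Qed.

Lemma arc_le_hex x z t : hex x true z t ->
  (c \in arc_A a -> x) -> (c \in arc_B a -> z) -> weak_le (arc_perm a) t.
Proof.
move=> tE cAx cBz; have nAB k : k \in arc_A a -> k \in arc_B a = false.
  by rewrite arc_AnB => ->; rewrite andbF.
apply/weak_leP => q p qp; rewrite arc_perm_inv // => /andP[pE qE].
have [pc|pc] := eqVneq p c; have [qc|qc] := eqVneq q c.
- by move: qp; rewrite pc qc ltnn.
- have cA : c \in arc_A a by move: pE; rewrite pc (negPf (ord_ltn_neq cd)) orbF.
  case/orP: qE => [qB|/eqP->]; last by rewrite pc (hex_c_lo tE) cAx.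
  by apply: (hex_outer_before tE qp); rewrite pc out_c out_B.
- have cB : c \in arc_B a by move: qE; rewrite qc eq_sym (negPf (ord_ltn_neq ac)) orbF.
  case/orP: pE => [pA|/eqP->]; last by rewrite qc (hex_hi_c tE) cBz.
  by apply: (hex_outer_before tE qp); rewrite qc out_c out_A.
case/orP: pE qp => [pA|/eqP->] qp; case/orP: qE qp => [qB|/eqP->] qp.
- by apply: (hex_outer_before tE qp); rewrite out_A // out_B.
- by apply: (hex_outer_before tE qp); rewrite out_A // out_lo.
- by apply: (hex_outer_before tE qp); rewrite out_hi out_B.
by rewrite (hex_hi_lo tE).
Qed.

(** The top vertex of the hexagon is the join of [s] and [arc_perm b], so
    [arc_transfer] applies. *)
Lemma hex_contract b x y z s t : b \notin arcs_of R -> hex x y z s -> hex true true true t ->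
  (forall q p : 'I_n, q < p -> before (arc_perm b) p q ->
     (p != arc_hi b) || (q != arc_lo b) -> hex_outer p < hex_outer q) ->
  (arc_lo b == c) && (arc_hi b == hi) && x || (arc_lo b == lo) && (arc_hi b == c) && z ->
  R s t.
Proof.
move=> bR sE tE bout bE.
apply: (arc_transfer bR) => [q p qp jpq pq|].
  by apply: (hex_outer_before sE qp); apply: bout pq.
split; first by apply: hex_le sE tE _ _ _; rewrite implybT.
  apply/weak_leP => q p qp jpq; case pq : ((p != arc_hi b) || (q != arc_lo b)).
    by apply: (hex_outer_before tE qp); apply: bout pq.
  move: pq => /negbT; rewrite negb_or !negbK => /andP[/eqP-> /eqP->].
  by case/orP: bE => /andP[/andP[/eqP-> /eqP->] _]; rewrite (hex_hi_c tE, hex_c_lo tE).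
move=> r /weak_leP sr /weak_leP br.
have bb := br _ _ (arc_lo_hi b) (arc_perm_hi_lo b).
have rcl : before r c lo.
  case/orP: bE => /andP[/andP[/eqP bl /eqP bh] xz]; last by rewrite -bl -bh.
  by apply: sr => //; rewrite (hex_c_lo sE).
have rhc : before r hi c.
  case/orP: bE => /andP[/andP[/eqP bl /eqP bh] xz]; first by rewrite -bl -bh.
  by apply: sr => //; rewrite (hex_hi_c sE).
apply/weak_leP => q p qp; rewrite tE //.
case/or4P => [opq|/and3P[/eqP-> /eqP-> _]|/and3P[/eqP-> /eqP-> _]|/and3P[/eqP-> /eqP-> _]] //.
  by apply: sr => //; apply: hex_outer_before sE qp opq.
exact: before_trans rhc rcl.
Qed.


Lemma hex_contracted_join x z s t : hex x false z s -> hex true true true t ->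
  R s t -> a \notin arcs_of R.
Proof.
move=> sE tE st; apply: (arc_contracted st); first exact: (arc_le_hex tE).
by rewrite (hex_hi_lo sE).
Qed.

(** The vertices [s] and [s'] are the two coatoms of the hexagon; their meet does
    not invert [hi] and [lo], while [s'] does. *)
Lemma hex_contracted_meet x z s s' t : hex x true z s -> hex (~~ x) true (~~ z) s' ->
  hex true true true t -> R s t -> x != z ->
  (c \in arc_A a -> ~~ x) -> (c \in arc_B a -> ~~ z) -> a \notin arcs_of R.
Proof.
move=> sE sE' tE st xz cAx cBz; have [m mP] := meet_exists s s'.
have [/weak_leP ms /weak_leP ms' _] := mP.
have ms'R : R m s'.
  apply: cong_meet st (cong_refl s') mP (meet_ge _).
  by apply: hex_le sE' tE _ _ _; rewrite implybT.
apply: (arc_contracted ms'R); first exact: (arc_le_hex sE').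
apply/negP => mhl; have /orP[mhc|mcl] := before_split mhl (ord_ltn_neq cd).
  have := ms _ _ cd mhc; have := ms' _ _ cd mhc.
  by rewrite (hex_hi_c sE) (hex_hi_c sE'); case: z {sE sE' xz cBz}.
have := ms _ _ ac mcl; have := ms' _ _ ac mcl.
by rewrite (hex_c_lo sE) (hex_c_lo sE'); case: x {sE sE' xz cAx}.
Qed.

(** If [b] joins [c] to [hi] and [c] is in [arc_A a], or [b] joins [lo] to [c] and
    [c] is in [arc_B a], it is enough to join [arc_perm b] with an atom of the
    hexagon; otherwise the contracted edge at the top is pushed down by a meet. *)
Lemma hex_subarc_contracted b : b \notin arcs_of R ->
  arc_A b \subset arc_A a -> arc_B b \subset arc_B a ->
  (arc_lo b == c) && (arc_hi b == hi) || (arc_lo b == lo) && (arc_hi b == c) ->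
  a \notin arcs_of R.
Proof.
move=> bR /subsetP bA /subsetP bB bE.
have bout (q p : 'I_n) : q < p -> before (arc_perm b) p q ->
     (p != arc_hi b) || (q != arc_lo b) -> hex_outer p < hex_outer q.
  have Ac k : k \in arc_A b -> hex_outer k = 0.
    move=> kb; rewrite out_A ?bA //; have := arc_A_sub kb.
    by case/orP: bE => /andP[/eqP-> /eqP->]; apply: contraTneq => ->; rewrite ltnn ?andbF.
  have Bc k : k \in arc_B b -> hex_outer k = 2.
    move=> kb; rewrite out_B ?bB //; have := arc_B_sub kb.
    by case/orP: bE => /andP[/eqP-> /eqP->]; apply: contraTneq => ->; rewrite ltnn ?andbF.
  have lh : hex_outer (arc_lo b) = 1 /\ hex_outer (arc_hi b) = 1.
    by case/orP: bE => /andP[/eqP-> /eqP->].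
  move=> qp; rewrite arc_perm_inv // => /andP[/orP[/Ac->|/eqP->] /orP[/Bc->|/eqP->]];
  by rewrite ?lh.1 ?lh.2 ?eqxx.
have [t tE] := @hex_exists true true true isT isT.
have cAB : (c \in arc_A a) || (c \in arc_B a) by rewrite arc_AB.
have nAB : c \in arc_A a -> c \in arc_B a = false by rewrite arc_AnB => ->; rewrite andbF.
case/orP: bE => bE; case/orP: cAB => cAB.
- have [s sE] := @hex_exists true false false isT isT.
  by apply: (hex_contracted_join sE tE); apply: (hex_contract bR sE tE bout); rewrite bE.
- have [s sE] := @hex_exists true true false isT isT.
  have [s' sE'] := @hex_exists false true true isT isT.
  apply: (hex_contracted_meet sE sE' tE) => //; last by move/nAB; rewrite cAB.
  by apply: (hex_contract bR sE tE bout); rewrite bE.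
- have [s sE] := @hex_exists false true true isT isT.
  have [s' sE'] := @hex_exists true true false isT isT.
  apply: (hex_contracted_meet sE sE' tE) => //; last by rewrite (nAB cAB).
  by apply: (hex_contract bR sE tE bout); rewrite bE orbT.
have [s sE] := @hex_exists false false true isT isT.
by apply: (hex_contracted_join sE tE); apply: (hex_contract bR sE tE bout); rewrite bE orbT.
Qed.
End Hexagon.

Lemma arc_eq (a b : arc n) : arc_lo b = arc_lo a -> arc_hi b = arc_hi a ->
  arc_A b \subset arc_A a -> arc_B b \subset arc_B a -> b = a.
Proof.
move=> lE hE /subsetP bA /subsetP bB.
have AE : arc_A b = arc_A a.
  apply/setP => k; apply/idP/idP => [/bA //|kA].
  have := arc_AB b k; rewrite lE hE (arc_A_sub kA) => /orP[//|/bB].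
  by rewrite arc_AnB kA andbF.
have BE : arc_B b = arc_B a by apply/setP => k; rewrite !arc_AnB lE hE AE.
apply: val_inj; move: lE hE AE BE; rewrite /arc_lo /arc_hi /arc_A /arc_B /=.
by case: (arc_val a) => [[[? ?] ?] ?]; case: (arc_val b) => [[[? ?] ?] ?] /= -> -> -> ->.
Qed.

(** First lengthen [b] to the left end of [a], then to the right end. *)
Lemma subarc_contracted (a b : arc n) : subarc b a ->
  b \notin arcs_of R -> a \notin arcs_of R.
Proof.
case/and4P=> lab hba bA bB bR.
have [g [gR gl gh gA gB]] : exists g : arc n, [/\ g \notin arcs_of R, arc_lo g = arc_lo a,
    arc_hi g = arc_hi b, arc_A g \subset arc_A a & arc_B g \subset arc_B a].
  move: lab; rewrite leq_eqVlt => /orP[/eqP/val_inj lE|lab]; first by exists b.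
  have lh : arc_lo a < arc_hi b by apply: ltn_trans lab (arc_lo_hi b).
  have [g [gl gh gA]] := arc_exists (fun k => k \in arc_A a) lh.
  have gAs : arc_A g \subset arc_A a by apply/subsetP => k; rewrite gA => /andP[].
  have gBs : arc_B g \subset arc_B a.
    apply/subsetP => k; rewrite !arc_AnB gl gh gA => /andP[/andP[lk kh]].
    by rewrite lk kh /= => ->; rewrite (leq_trans kh hba).
  exists g; split=> //; apply: (@hex_subarc_contracted g (arc_lo b) _ b bR).
  - by rewrite gl gh lab arc_lo_hi.
  - apply/subsetP => k kb; rewrite gA (subsetP bA k kb) andbT.
    by have /andP[lk ->] := arc_A_sub kb; rewrite (ltn_trans lab lk).
  - apply/subsetP => k kb; have := subsetP bB k kb; rewrite !arc_AnB gA gl gh.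
    case/andP=> /andP[-> _] /negPf ->; rewrite andbF andbT.
    by have /andP[_ ->] := arc_B_sub kb.
  by rewrite gh !eqxx.
move: hba; rewrite leq_eqVlt => /orP[/eqP/val_inj hE|hba].
  by rewrite -(@arc_eq a g) // gh.
apply: (@hex_subarc_contracted a (arc_hi b) _ g gR) => //.
  by rewrite hba -gh -gl arc_lo_hi.
by rewrite gl gh !eqxx orbT.
Qed.

(** A contracted subarc of least length has no contracted strict subarc, so
    simplicity applies to it. *)
Lemma minimal_contracted_subarc (a : arc n) : simple_congruence R ->
  a \notin arcs_of R ->
  exists b : arc n, [/\ subarc b a, b \notin arcs_of R & up_arc b || down_arc b].
Proof.
move=> Rs aR; pose Q b := subarc b a && (b \notin arcs_of R).
have Qa : Q a by rewrite /Q aR /subarc !leqnn !subxx.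
case: (arg_minnP (fun b : arc n => arc_hi b - arc_lo b) Qa) => b /andP[ba bR] bmin.
exists b; split=> //; apply: Rs => // g /andP[/and4P[gl gh gA gB] ngb].
apply: contraNT ngb => gR.
have Qg : Q g.
  have /and4P[bl bh bA bB] := ba; rewrite /Q gR andbT /subarc.
  by rewrite (leq_trans bl gl) (leq_trans gh bh) (subset_trans gA bA) (subset_trans gB bB).
have min := bmin g Qg; have lh := arc_lo_hi g.
apply/eqP/arc_eq => //; apply: val_inj; move: gl gh lh min => /=; clear; lia.
Qed.

End Contraction.

(** * Posets with walls *)

Definition crosses n (u v j : 'I_n) : bool := (u < j < v) || (v < j < u).

Definition dual n (P : rel 'I_n) : rel 'I_n := fun x y => P y x.

Definition within n (c d u v : 'I_n) : bool := (u <= c) && (d <= v) || (v <= c) && (d <= u).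

(** [UC c d] and [DC c d] stand for: the up (resp. down) arc from [c] to [d] is
    contracted.  By [ws_up] and [ws_down] a cover relation cannot pass over such
    an arc when some linear extension has the two ends adjacent and the interior
    of the arc on the required side.  By [ws_below] and [ws_above] two
    incomparable values may be made adjacent as early (resp. as late) as
    possible, and their incomparability is due to such an arc. *)
Record wall_system n (P : rel 'I_n) (UC DC : 'I_n -> 'I_n -> Prop) : Prop := {
  ws_poset : poset P;
  ws_next : forall a b : 'I_n, b = a.+1 :> nat -> P a b || P b a;
  ws_up : forall u v c d, hasse P u v -> UC c d -> within c d u v ->
    exists2 k : 'I_n, c < k < d & P u k;
  ws_down : forall u v c d, hasse P u v -> DC c d -> within c d u v ->
    exists2 k : 'I_n, c < k < d & P k v;
  ws_below : forall x y : 'I_n, x < y -> ~~ P x y -> ~~ P y x ->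
    exists c d : 'I_n, [/\ x <= c, c < d, d <= y &
      (UC c d /\ forall k : 'I_n, c < k < d -> P k x || P k y) \/
      (DC c d /\ forall k : 'I_n, c < k < d -> ~~ (P k x || P k y))];
  ws_above : forall x y : 'I_n, x < y -> ~~ P x y -> ~~ P y x ->
    exists c d : 'I_n, [/\ x <= c, c < d, d <= y &
      (DC c d /\ forall k : 'I_n, c < k < d -> P x k || P y k) \/
      (UC c d /\ forall k : 'I_n, c < k < d -> ~~ (P x k || P y k))] }.

Lemma hasse_dual n (P : rel 'I_n) x y : hasse (dual P) x y = hasse P y x.
Proof.
rewrite /hasse /dual eq_sym; congr [&& _, _ & _]; apply: eq_forallb => k.
by rewrite andbC orbC.
Qed.

Lemma wall_system_dual n (P : rel 'I_n) UC DC :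
  wall_system P UC DC -> wall_system (dual P) DC UC.
Proof.
case=> -[Pr Pa Pt] nx up dn bl ab; split=> //.
- split=> // [x y /andP[xy yx]|y x z xy yz]; first by apply: Pa; rewrite /dual in xy yx; rewrite xy yx.
  exact: Pt yz xy.
- by move=> a b /nx; rewrite orbC.
- move=> u v c d; rewrite hasse_dual => uv cd w; apply: (dn _ _ _ _ uv cd).
  by rewrite /within orbC.
- move=> u v c d; rewrite hasse_dual => uv cd w; apply: (up _ _ _ _ uv cd).
  by rewrite /within orbC.
- by move=> x y xy nxy nyx; apply: ab.
- by move=> x y xy nxy nyx; apply: bl.
Qed.

(** * Hasse diagrams *)

Section HasseDiagram.
Variables (n : nat) (P : rel 'I_n).
Hypothesis Pp : poset P.

Let Pr : reflexive P. Proof. by case: Pp. Qed.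
Let Pa : antisymmetric P. Proof. by case: Pp. Qed.
Let Pt : transitive P. Proof. by case: Pp. Qed.

Lemma hasseP u v : hasse P u v ->
  [/\ P u v, u != v, ~~ P v u & forall k, P u k -> P k v -> k = u \/ k = v].
Proof.
case/and3P=> uv nuv /forallP h; split=> // [|k uk kv].
  by apply: contra nuv => vu; apply/eqP/Pa; rewrite uv vu.
by have /implyP := h k; rewrite uk kv => /(_ isT) /orP[] /eqP; [left|right].
Qed.

Lemma first_cover u v : P u v -> u != v -> exists2 w, hasse P u w & P w v.
Proof.
move=> uv nuv; pose Q w := [&& P u w, P w v & w != u].
have Qv : Q v by rewrite /Q uv Pr eq_sym nuv.
case: (arg_minnP (fun w => #|[set z | P z w]|) Qv) => w /and3P[uw wv nwu] wmin.
exists w => //; apply/and3P; split=> //; first by rewrite eq_sym.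
apply/forallP => k; apply/implyP => /andP[uk kw].
apply/orP; case: (eqVneq k u) => [|ku]; first by left.
right; apply/negPn/negP => nkw.
have /wmin : Q k by rewrite /Q uk (Pt kw wv).
rewrite leqNgt => /negP; apply; apply/proper_card/properP; split.
  by apply/subsetP => z; rewrite !inE => /Pt; apply.
exists w; rewrite !inE ?Pr //; apply: contra nkw => wk.
by apply/eqP/Pa; rewrite kw wk.
Qed.

Lemma connect_hasse u v : P u v -> connect (hasse P) u v.
Proof.
have [m] := ubnP #|[set z | P u z]|; elim: m u => // m IH u le uv.
case: (eqVneq u v) => [->|nuv]; first exact: connect0.
have [w uw wv] := first_cover uv nuv.
have [uw' nuw nwu _] := hasseP uw.
apply: connect_trans (connect1 uw) (IH _ _ wv).
rewrite ltnS in le; apply: leq_trans le; apply/proper_card/properP; split.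
  by apply/subsetP => z; rewrite !inE; apply: Pt.
by exists u; rewrite !inE ?Pr.
Qed.

End HasseDiagram.

Lemma adjacent_exit n (Q : pred 'I_n) (i j : 'I_n) : Q j -> ~~ Q i ->
  exists p q : 'I_n, [/\ Q q, ~~ Q p, (i <= p <= j) || (j <= p <= i),
   (i <= q <= j) || (j <= q <= i) & (p = q.+1 :> nat) \/ (q = p.+1 :> nat)].
Proof.
move=> Qj nQi.
have [m] := ubnP (i - j + (j - i)); elim: m i nQi => // m IH i nQi le.
have [ij|ji|/val_inj e] := ltngtP i j; last by rewrite e Qj in nQi.
  have i1 : i.+1 < n by have := ltn_ord j; lia.
  have [Q1|nQ1] := boolP (Q (Ordinal i1)).
    by exists i, (Ordinal i1); split=> //=; (try lia); right.
  have [|p [q [Qq nQp bp bq pq]]] := IH _ nQ1; first by rewrite /=; lia.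
  by exists p, q; split=> //; move: bp bq => /=; lia.
have i1 : i.-1 < n by have := ltn_ord i; lia.
have [Q1|nQ1] := boolP (Q (Ordinal i1)).
  by exists i, (Ordinal i1); split=> //=; (try lia); left; lia.
have [|p [q [Qq nQp bp bq pq]]] := IH _ nQ1; first by rewrite /=; lia.
by exists p, q; split=> //; move: bp bq => /=; lia.
Qed.

(** * Walls above the nodes with two parents *)

Section Walls.
Variables (n : nat) (P : rel 'I_n) (UC DC : 'I_n -> 'I_n -> Prop).
Hypothesis ws : wall_system P UC DC.

Let Pp := ws_poset ws.
Let Pr : reflexive P. Proof. by case: Pp. Qed.
Let Pa : antisymmetric P. Proof. by case: Pp. Qed.
Let Pt : transitive P. Proof. by case: Pp. Qed.

Lemma covers_incomparable j x y : hasse P j x -> hasse P j y -> x != y -> ~~ P x y.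
Proof.
move=> /(hasseP Pp)[jx njx _ _] /(hasseP Pp)[_ _ _ h] nxy.
by apply/negP => xy; have [|/eqP] := h _ jx xy; [move/eqP; rewrite eq_sym (negPf njx)|rewrite (negPf nxy)].
Qed.

(** If [x < y] were both above [j] in value, the arc separating [x] from [y] would
    be passed over by the cover from [j] to [y]. *)
Lemma covers_opposite j x y : hasse P j x -> hasse P j y -> x != y -> crosses x y j.
Proof.
wlog xy : x y / x < y.
  move=> W jx jy nxy; have [|xy|xy] := ltngtP x y; first by move=> xy; apply: W.
    by rewrite /crosses orbC; apply: W; rewrite // eq_sym.
  by rewrite (val_inj xy) eqxx in nxy.
move=> jx jy nxy.
have inc1 := covers_incomparable jx jy nxy.
have inc2 : ~~ P y x by apply: covers_incomparable jy jx _; rewrite eq_sym.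
have [jxP njx _ hx] := hasseP Pp jx; have [jyP njy _ hy] := hasseP Pp jy.
have [c [d [xc cd dy alt]]] := ws_below ws xy inc1 inc2.
suff : ~~ ((j <= x) || (y <= j)) by rewrite /crosses; clear; lia.
apply/negP => out.
have [z [jz hz zE]] : exists z, [/\ hasse P j z, within c d j z & z \in [:: x; y]].
  case/orP: out => out.
    by exists y; rewrite !inE eqxx orbT /within (leq_trans out xc) dy.
  by exists x; rewrite !inE eqxx /within (leq_trans dy out) xc orbT.
case: alt => -[C Ck].
  have [k ck jk] := ws_up ws jz C hz.
  have : k = j \/ k = x \/ k = y.
    by have /orP[kx|ky] := Ck k ck; [have [] := hx k jk kx|have [] := hy k jk ky]; auto.
  by case=> [|[]] kE; move: ck out xc dy; rewrite kE; clear; lia.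
have [k ck kz] := ws_down ws jz C hz.
by have := Ck k ck; move: zE; rewrite !inE => /orP[] /eqP zE; rewrite -zE kz ?orbT.
Qed.

(** In every linear extension the interior of this contracted up arc is exhausted
    as soon as [j] has been listed. *)
Definition wall (j : 'I_n) := exists c d : 'I_n,
  [/\ UC c d, c < j < d & forall k : 'I_n, c < k < d -> P k j].

(** If [u] is not below [j], neither is [v], so both avoid the interior of the arc
    and the cover passes over it although nothing of its interior is above [u]. *)
Lemma wall_cover j u v : wall j -> hasse P u v -> crosses u v j -> P u j.
Proof.
case=> c [d [C cjd Ck]] uv cr; apply/negPn/negP => nuj.
have [uvP _ _ _] := hasseP Pp uv.
have nvj : ~~ P v j by apply: contra nuj; apply: Pt.
have := contraNN (Ck u) nuj; have := contraNN (Ck v) nvj => hv hu.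
have wi : within c d u v by move: cr hu hv cjd; rewrite /crosses /within; clear; lia.
have [k /Ck kj uk] := ws_up ws uv C wi.
by rewrite (Pt uk kj) in nuj.
Qed.

(** Away from the elements below [j], the Hasse diagram never jumps over [j]. *)
Lemma wall_path j a p : wall j -> path (undirected (hasse P)) a p ->
  all (fun z => ~~ P z j) (a :: p) -> (last a p < j) = (a < j).
Proof.
move=> wj; elim: p a => //= b p IH a /andP[ab pp] /and3P[na nb np].
rewrite (IH b) //=; last by rewrite nb np.
have neq z : ~~ P z j -> nat_of_ord z != j.
  by apply: contra => /eqP /val_inj ->.
have := neq _ na; have := neq _ nb.
have /orP[ab'|ab'] := ab; have := contraNN (wall_cover wj ab').
  by move/(_ na); rewrite /crosses; clear; lia.
by move/(_ nb); rewrite /crosses; clear; lia.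
Qed.

Lemma wall_chain j a b : wall j -> ~~ P a j -> P a b -> (b < j) = (a < j).
Proof.
move=> wj na ab; have /connectP[p pp ->] := connect_hasse Pp ab.
apply: wall_path => //.
  by apply: sub_path pp => x y xy; rewrite /undirected xy.
rewrite /= na; elim: p a na pp {ab} => //= c p IH a na /andP[ac pp].
have nc : ~~ P c j.
  by have [acP _ _ _] := hasseP Pp ac; apply: contra na; apply: Pt.
by rewrite nc /=; apply: IH pp.
Qed.

Lemma maximal_lower_bound q a b : P q a -> P q b -> exists m, [/\ P m a, P m b
  & forall m', P m' a -> P m' b -> P m m' -> m' = m].
Proof.
move=> qa qb; pose Q m := P m a && P m b.
have Qq : Q q by rewrite /Q qa.
case: (arg_maxnP (fun w => #|[set z | P z w]|) Qq) => m /andP[ma mb] mmax.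
exists m; split=> // m' ma' mb' mm'; apply/eqP/negPn/negP => ne.
have /mmax : Q m' by rewrite /Q ma'.
rewrite /= leqNgt => /negP; apply; apply/proper_card/properP; split.
  by apply/subsetP => z; rewrite !inE => /Pt; apply.
exists m'; rewrite !inE ?Pr //; apply: contra ne => m'm.
by apply/eqP/Pa; rewrite m'm mm'.
Qed.

(** The incomparability of [x] and [y] yields a contracted arc; since it does not
    forbid the covers from [j] to [x] and to [y], it is an up arc passing over
    [j].  Were some value of its interior not below [j], then walking towards [j]
    along consecutive, hence comparable, values would reach a [p] incomparable to
    [j] having a common lower bound with [j].  A maximal common lower bound [m] has two
    upper covers, one leading to [p], the other to [j], so by induction there is
    a wall above [m], with [p] and [j] on opposite sides.  But [p] and [j] are
    both below [x] or [y], and these are on the same side of [m] as [j]. *)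
Lemma wall_exists j x y : hasse P j x -> hasse P j y -> x < j < y -> wall j.
Proof.
have [N] := ubnP #|[set z | P z j]|.
elim: N j x y => // N IH j x y le jx jy /andP[xj jy'].
have xy : x < y by apply: ltn_trans jy'.
have nxy : x != y by apply: contraTneq xy => ->; rewrite ltnn.
have inc1 := covers_incomparable jx jy nxy.
have inc2 : ~~ P y x by apply: covers_incomparable jy jx _; rewrite eq_sym.
have [jxP njx _ hx] := hasseP Pp jx; have [jyP njy _ hy] := hasseP Pp jy.
have [c [d [xc cd dy alt]]] := ws_below ws xy inc1 inc2.
have within_side : ~~ (c < j < d) -> exists z, [/\ hasse P j z, within c d j z & z \in [:: x; y]].
  move=> out; have /orP[dj|jc] : (d <= j) || (j <= c) by move: out; clear; lia.
    by exists x; rewrite !inE eqxx /within xc dj orbT.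
  by exists y; rewrite !inE eqxx orbT /within dy jc.
case: alt => -[C Ck]; last first.
  have cjd : ~~ (c < j < d) by apply/negP => /Ck; rewrite jxP.
  have [z [jz hz zE]] := within_side cjd; have [k ck kz] := ws_down ws jz C hz.
  by have := Ck k ck; move: zE; rewrite !inE => /orP[] /eqP zE; rewrite -zE kz ?orbT.
(* The interior lies below [x] or [y], which cover [j]. *)
have noj (k : 'I_n) : c < k < d -> P j k -> k = j.
  move=> ck jk; have : k = j \/ k = x \/ k = y.
    by have /orP[kx|ky] := Ck k ck; [have [] := hx k jk kx|have [] := hy k jk ky]; auto.
  by case=> [//|[]] kE; move: ck xc dy; rewrite kE; clear; lia.
have cjd : c < j < d.
  apply/negPn/negP => cjd; have [z [jz hz zE]] := within_side cjd.
  have [k ck jk] := ws_up ws jz C hz.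
  by move: cjd; rewrite -(noj k ck jk) ck.
exists c, d; split=> // k ck; apply/negPn/negP => nkj.
have [p [q [qj npj pb qb pq]]] := adjacent_exit (Q := P^~ j) (Pr j) nkj.
have cp : c < p < d by move: pb ck cjd; clear; lia.
have cq : c < q < d by move: qb ck cjd; clear; lia.
have qp : P q p.
  have : P q p || P p q by case: pq => /(ws_next ws); rewrite // orbC.
  by case/orP => // pq'; rewrite (Pt pq' qj) in npj.
have njp : ~~ P j p by apply: contra npj => /(noj p cp) ->.
have [m [mp mj mmax]] := maximal_lower_bound qp qj.
have nmp : m != p by apply: contraNneq npj => <-.
have nmj : m != j by apply: contraNneq njp => <-.
have [m1 mm1 m1p] := first_cover Pp mp nmp.
have [m2 mm2 m2j] := first_cover Pp mj nmj.
have [mm1' nm1 nm1' _] := hasseP Pp mm1; have [mm2' nm2 nm2' _] := hasseP Pp mm2.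
have n12 : m1 != m2.
  apply/negP => /eqP e; have := mmax m1 m1p; rewrite e => /(_ m2j mm2') e'.
  by rewrite e' eqxx in nm2.
have cr := covers_opposite mm1 mm2 n12.
have lem : #|[set z | P z m]| < N.
  rewrite ltnS in le; apply: leq_trans le; apply/proper_card/properP; split.
    by apply/subsetP => z; rewrite !inE => /Pt; apply.
  exists j; rewrite !inE ?Pr //; apply: contra nmj => jm.
  by apply/eqP/Pa; rewrite mj jm.
have wm : wall m.
  by case/orP: (cr) => cr'; [apply: (IH m m1 m2)|apply: (IH m m2 m1)].
have npm : ~~ P p m by apply: contra nmp => pm; apply/eqP/Pa; rewrite mp pm.
have njm : ~~ P j m by apply: contra nmj => jm; apply/eqP/Pa; rewrite mj jm.
have e1 := wall_chain wm nm1' m1p; have e2 := wall_chain wm nm2' m2j.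
have e3 : (p < m) = (j < m).
  by have /orP[pz|pz] := Ck p cp; rewrite -(wall_chain wm npm pz) (wall_chain wm njm).
by move: cr e1 e2 e3; rewrite /crosses; clear; lia.
Qed.

Lemma parents_wall j x y : hasse P j x -> hasse P j y -> x != y -> wall j.
Proof.
move=> jx jy nxy; have /orP[] := covers_opposite jx jy nxy.
  exact: wall_exists.
exact: wall_exists.
Qed.

End Walls.

(** * Acyclicity and separation *)

Section Trees.
Variables (T : finType) (e : rel T).
Let g := undirected e.
Hypothesis acyclic : forall c : seq T, ucycle g c -> size c <= 2.

Lemma remove_node_sub j : subrel (remove_node e j) g.
Proof. by move=> x y /and3P[]. Qed.

Lemma undirected_sym : symmetric g.
Proof. by move=> x y; rewrite /g /undirected orbC. Qed.

Lemma remove_path_notin j x p : x != j -> path (remove_node e j) x p -> j \notin x :: p.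
Proof.
elim: p x => [|y p IH] x xj /=; first by rewrite inE eq_sym.
move=> /andP[/and3P[_ yj _] pp]; rewrite inE negb_or eq_sym xj /=; exact: IH.
Qed.

(** A path joining two neighbours of [j] in the complement of [j] closes up,
    through [j], into a cycle. *)
Lemma neighbours_disconnected j x y : g j x -> g j y -> x != y -> x != j ->
  ~~ connect (remove_node e j) x y.
Proof.
move=> jx jy nxy xj; apply/negP => /connectP[p pp yE].
case/shortenP: pp yE => p' pp up _ yE.
have /acyclic : ucycle g (j :: x :: p').
  rewrite /ucycle /= rcons_path jx (sub_path (@remove_node_sub j) pp) -yE.
  by rewrite undirected_sym jy (remove_path_notin xj pp).
by case: p' yE {pp up} => //= yE; rewrite yE eqxx in nxy.
Qed.
End Trees.

Section SeparatingTree.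
Variables (n : nat) (P : rel 'I_n) (UC DC : 'I_n -> 'I_n -> Prop).
Hypothesis ws : wall_system P UC DC.

Let Pp := ws_poset ws.
Let Pr : reflexive P. Proof. by case: Pp. Qed.
Let Pa : antisymmetric P. Proof. by case: Pp. Qed.
Let Pt : transitive P. Proof. by case: Pp. Qed.
Let g := undirected (hasse P).

(** At a [P]-minimal vertex [j] of the cycle, the remaining vertices are not below
    [j], so they stay on one side of [j] by [wall_path]; but the two neighbours of
    [j] are upper covers, on opposite sides. *)
Lemma hasse_acyclic (c : seq 'I_n) : ucycle g c -> size c <= 2.
Proof.
case: c => // z c; rewrite leqNgt => uc; apply/negP => sz.
case: (@arg_minnP _ z (mem (z :: c)) (fun w => #|[set k | P k w]|)) => [|j jc jmin].
  exact: mem_head.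
have jmin' w : w \in z :: c -> P w j -> w = j.
  move=> wc wj; apply/eqP/negPn/negP => ne.
  have := jmin w wc; rewrite leqNgt => /negP; apply; apply/proper_card/properP; split.
    by apply/subsetP => k; rewrite !inE => /Pt; apply.
  exists j; rewrite !inE ?Pr //; apply: contra ne => jw.
  by apply/eqP/Pa; rewrite wj jw.
have [i s cE] := rot_to jc.
have [cyc un] : path.cycle g (j :: s) /\ uniq (j :: s).
  by rewrite -cE rot_cycle rot_uniq; case/andP: uc.
have sE : size s = size c by have := congr1 size cE; rewrite size_rot => -[].
have jmin'' w : w \in s -> ~~ P w j.
  move=> ws'; apply/negP => /jmin' wj; move: un => /=; rewrite -{1}wj ?ws' //.
  by rewrite -(mem_rot i) cE inE ws' orbT.
case: s cE sE cyc un jmin'' => [|x s] _ sE; first by move: sz => /=; rewrite -sE.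
rewrite /= rcons_path => /andP[jx /andP[pp yj]] /andP[nj /andP[nx us]] jm.
set y := last x s in yj.
have ys : y \in s.
  by rewrite /y; case: (s) sE => [|a t] sE /=; [move: sz => /=; rewrite -sE|exact: mem_last].
have nxy : x != y by apply: contraNneq nx => ->.
have hx : hasse P j x.
  have := jm x (mem_head _ _); case/orP: jx => // xj.
  by have [-> _ _ _] := hasseP Pp xj.
have hy : hasse P j y.
  have := jm y; rewrite inE ys orbT; case/orP: yj => // yj.
  by have [-> _ _ _] := hasseP Pp yj => /(_ isT).
have wj := parents_wall ws hx hy nxy.
have := wall_path ws wj pp; rewrite -/y => /(_ _)/wrap[].
  by apply/allP => w /jm.
by have := covers_opposite ws hx hy nxy; rewrite /crosses; clear; lia.
Qed.

Lemma chain_avoids j u p : path (hasse P) u p -> ~~ P j (last u p) ->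
  path (remove_node (hasse P) j) u p.
Proof.
elim: p u => //= a p IH u /andP[ua pp] nj; rewrite IH // andbT.
have [uaP _ _ _] := hasseP Pp ua.
have al : P a (last a p).
  elim: p a pp {IH nj ua uaP} => //= b p IH a /andP[ab /IH bl].
  by have [abP _ _ _] := hasseP Pp ab; apply: Pt bl.
rewrite /remove_node /undirected ua andbT.
by apply/andP; split; apply: contraNneq nj => <- //; apply: Pt al.
Qed.

(** [wall_path] applies as soon as the path from [x] meets no element below [j].
    From such an element a chain of covers climbs to a child of [j] without using
    [j], so that child and the parent [x] would be connected in the complement
    of [j]. *)
Lemma ancestors_side j x y z : hasse P j x -> hasse P j y -> x != y ->
  connect (remove_node (hasse P) j) x z -> z != j /\ (z < j) = (x < j).
Proof.
move=> jx jy nxy /connectP[p pp zE].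
have [jxP njx nxj _] := hasseP Pp jx.
have jp : j \notin x :: p by apply: remove_path_notin pp; rewrite eq_sym.
split; first by apply: contraNneq jp => <-; rewrite zE mem_last.
rewrite zE; apply: (wall_path ws (parents_wall ws jx jy nxy)).
  exact: sub_path (@remove_node_sub _ _ j) _ _ pp.
apply/allP => u up; apply/negP => uj.
have nuj : u != j by apply: contraNneq jp => <-.
have xu : connect (remove_node (hasse P) j) x u.
  move: up pp; case/splitPl => p1 p2 e; rewrite cat_path => /andP[pp1 _].
  by apply/connectP; exists p1.
have [w jw uw] : exists2 w, hasse P w j & P u w.
  have nju : j != u by rewrite eq_sym.
  have [w] := first_cover (ws_poset (wall_system_dual ws)) (uj : dual P j u) nju.
  by rewrite hasse_dual; exists w.
have [wjP nwj njw _] := hasseP Pp jw.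
have uw' : connect (remove_node (hasse P) j) u w.
  have /connectP[q qq wE] := connect_hasse Pp uw.
  by apply/connectP; exists q => //; apply: chain_avoids; rewrite -?wE.
have nxw : x != w by apply: contraNneq nxj => ->.
have gx : undirected (hasse P) j x by rewrite /undirected jx.
have gw : undirected (hasse P) j w by rewrite /undirected jw orbT.
have nxj' : x != j by rewrite eq_sym.
by have /negP[] := neighbours_disconnected hasse_acyclic gx gw nxw nxj'; apply: connect_trans uw'.
Qed.

Lemma card_parents j : #|parents (hasse P) j| <= 2.
Proof.
rewrite -(cardsID [set x : 'I_n | x < j] (parents (hasse P) j)).
have side (b : bool) (x y : 'I_n) : hasse P j x -> hasse P j y ->
    (x < j) = b -> (y < j) = b -> x = y.
  move=> jx jy xb yb; apply/eqP/negPn/negP => nxy.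
  move: (covers_opposite ws jx jy nxy) xb yb; rewrite /crosses; clear; lia.
rewrite -[2]/(1 + 1) leq_add //; apply/card_le1_eqP => x y.
  by rewrite !inE => /andP[jx xj] /andP[jy yj]; apply: (side true).
rewrite !inE => /andP[xj jx] /andP[yj jy].
by apply: (side false) => //; apply: negbTE.
Qed.

Lemma separated_parents j : #|parents (hasse P) j| = 2 ->
  separated j (ancestor_subtrees (hasse P) j).
Proof.
move=> /eqP/cards2P[x [y [nxy pE]]].
have [jx jy] : hasse P j x /\ hasse P j y.
  by split; [have := set21 x y|have := set22 x y]; rewrite -pE inE.
rewrite /ancestor_subtrees pE imsetU1 imset_set1 {pE}.
wlog xjy : x y nxy jx jy / x < j < y => [W|].
  have /orP[|yx] := covers_opposite ws jx jy nxy; first exact: W.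
  by rewrite setUC; apply: W yx => //; rewrite eq_sym.
exists (component (hasse P) j x), (component (hasse P) j y); split=> // z; rewrite inE.
  by case/(ancestors_side jx jy nxy); move: xjy; clear; lia.
rewrite eq_sym in nxy; case/(ancestors_side jy jx nxy); rewrite -val_eqE /=.
by move: xjy; clear; lia.
Qed.
End SeparatingTree.

Lemma wall_system_separating_tree n (P : rel 'I_n) UC DC :
  1 <= n -> wall_system P UC DC -> separating_tree (hasse P).
Proof.
move=> n0 ws; have wsd := wall_system_dual ws; have Pp := ws_poset ws.
have und : undirected (hasse (dual P)) =2 undirected (hasse P).
  by move=> x y; rewrite /undirected !(hasse_dual P) orbC.
have par j : parents (hasse (dual P)) j = children (hasse P) j.
  by apply/setP => x; rewrite !inE (hasse_dual P).
have comp j k : component (hasse (dual P)) j k = component (hasse P) j k.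
  apply/setP => x; rewrite !inE; apply: eq_connect => a b.
  by rewrite /remove_node und.
split; last first.
  move=> j; split; [exact: card_parents ws j|by rewrite -par; apply: card_parents wsd j| |].
    exact: separated_parents ws j.
  rewrite -par => /(separated_parents wsd).
  rewrite /descendant_subtrees /ancestor_subtrees par.
  by rewrite (eq_imset _ (comp j)).
split.
  move=> x y /(hasseP Pp)[_ _ nyx _]; apply: contra nyx.
  by case/(hasseP Pp).
split; [by rewrite card_ord| |exact: hasse_acyclic ws].
have sym := sym_connect_sym (@undirected_sym _ (hasse P)).
have sub a b : P a b -> connect (undirected (hasse P)) a b.
  move=> /(connect_hasse Pp); apply: connect_sub => u v uv.
  by apply: connect1; rewrite /undirected uv.
have step (a b : 'I_n) : b = a.+1 :> nat -> connect (undirected (hasse P)) a b.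
  by move=> /(ws_next ws) /orP[/sub //|/sub]; rewrite sym.
have up m (a b : 'I_n) : b = a + m :> nat -> connect (undirected (hasse P)) a b.
  elim: m b => [|m IH] b e; first by rewrite (val_inj (etrans e (addn0 _))) connect0.
  have bn : a + m < n by have := ltn_ord b; rewrite e; clear; lia.
  apply: connect_trans (IH (Ordinal bn) erefl) (step _ _ _).
  by rewrite e addnS.
move=> x y; case: (leqP x y) => [xy|/ltnW xy]; last rewrite sym.
  by apply: (up (y - x)); rewrite subnKC.
by apply: (up (x - y)); rewrite subnKC.
Qed.

(** * The poset of a congruence class *)

Lemma linear_extension_blocks n (P : rel 'I_n) (f : 'I_n -> nat) (s t : 'S_n) :
  linear_extension P s -> (forall a b, P a b -> f a <= f b) ->
  (forall a b, before t a b = (f a < f b) || (f a == f b) && before s a b) ->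
  linear_extension P t.
Proof.
move=> sP fP tE a b ab; rewrite leqNgt -/(before t b a) tE.
by have := sP _ _ ab; have := fP _ _ ab; rewrite /before; clear; lia.
Qed.

Section CongruencePoset.
Variables (n : nat) (R : rel 'S_n) (P : rel 'I_n) (s0 : 'S_n).
Hypothesis Rc : lattice_congruence R.
Hypothesis Rs : simple_congruence R.
Hypothesis Re : essential R.
Hypothesis Pp : poset P.
Hypothesis RP : forall t, R s0 t <-> linear_extension P t.

Let Pr : reflexive P. Proof. by case: Pp. Qed.
Let Pa : antisymmetric P. Proof. by case: Pp. Qed.
Let Pt : transitive P. Proof. by case: Pp. Qed.

Lemma linear_extensions_congruent s t :
  linear_extension P s -> linear_extension P t -> R s t.
Proof. by move=> /RP s0s /RP s0t; apply: cong_trans s0t => //; apply: cong_sym. Qed.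

Lemma congruent_linear_extension s t :
  R s t -> linear_extension P s -> linear_extension P t.
Proof. by move=> st /RP s0s; apply/RP; apply: cong_trans st. Qed.

(** The down-sets [D] for which [D], [u], [v], then the rest, is a block order
    compatible with [P] up to the order of [u] and [v]. *)
Definition ideal_at (D : pred 'I_n) (u v : 'I_n) :=
  [/\ ~~ D u, ~~ D v, forall k l, P k l -> D l -> D k
    & forall k, P k u || P k v -> [|| k == u, k == v | D k]].

Lemma ideal_atC D u v : ideal_at D u v -> ideal_at D v u.
Proof. by case=> Du Dv dD uvD; split=> // k; rewrite orbC => /uvD; rewrite orbCA. Qed.

Definition blocks (D : pred 'I_n) (u v k : 'I_n) : nat :=
  if D k then 0 else if k == u then 1 else if k == v then 2 else 3.

Lemma blocks_linear_extension D u v t : ideal_at D u v -> ~~ P v u ->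
  (forall a b, before t a b = (blocks D u v a < blocks D u v b) ||
    (blocks D u v a == blocks D u v b) && before s0 a b) ->
  linear_extension P t.
Proof.
case=> Du Dv dD uvD nvu; apply: linear_extension_blocks => [|a b ab].
  by apply/RP/cong_refl.
rewrite /blocks; case Da: (D a) => //; case Db: (D b); first by rewrite (dD _ _ ab Db) in Da.
have := uvD a; rewrite Da orbF.
case: (eqVneq b u) => [bu|nbu].
  rewrite -bu ab => /(_ isT); case: (eqVneq a b) => // _ /= /eqP av.
  by rewrite -av -bu ab in nvu.
case: (eqVneq b v) => [bv|nbv]; last by move=> _; case: (a == u); case: (a == v).
by rewrite -bv ab orbT => /(_ isT); case: (a == u) => //= ->.
Qed.

Lemma adjacent_extensions (D : pred 'I_n) (x y : 'I_n) : x < y -> ideal_at D x y ->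
  exists (a : arc n) (s t : 'S_n), [/\ arc_lo a = x, arc_hi a = y,
    forall k : 'I_n, (k \in arc_A a) = (x < k < y) && D k,
    swapped a s t & [/\ before s x y, before t y x,
    ~~ P y x -> linear_extension P s & ~~ P x y -> linear_extension P t]].
Proof.
move=> xy iD; have [Dx Dy _ _] := iD.
have [a [al ah aA]] := arc_exists D xy.
have [s sE] := perm_of_blocks (blocks D x y) s0.
have [t tE] := perm_of_blocks (blocks D y x) s0.
have nxy : (x == y) = false by apply/negbTE/ord_ltn_neq.
have nyx : (y == x) = false by rewrite eq_sym.
have aB k : k \in arc_B a -> D k = false.
  by rewrite arc_AnB aA al ah => /andP[-> /negbTE].
exists a, s, t; split=> //; last split.
- split; rewrite ?al ?ah.
  + by rewrite sE /blocks (negPf Dx) (negPf Dy) eqxx eqxx nyx.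
  + by move=> k; rewrite aA sE /blocks (negPf Dx) eqxx => /andP[_ ->].
  + move=> k kB; have /andP[xk ky] := arc_B_sub kB; rewrite al in xk; rewrite ah in ky.
    rewrite sE /blocks (negPf Dy) (aB k kB) eqxx nyx.
    by rewrite eq_sym (negPf (ord_ltn_neq xk)) (negPf (ord_ltn_neq ky)).
  move=> q p qp; rewrite sE tE /blocks. {
  have yx : (y < x) = false by apply/negbTE; rewrite -leqNgt ltnW.
  move: qp; have [px|px] := eqVneq p x; have [py|py] := eqVneq p y;
  have [qx|qx] := eqVneq q x; have [qy|qy] := eqVneq q y;
  rewrite ?px ?py ?qx ?qy ?eqxx ?nxy ?nyx ?ltnn ?yx ?(negPf Dx) ?(negPf Dy) //=.
  all: try by [move: nxy; rewrite -px py eqxx | move: nxy; rewrite -qx qy eqxx].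
  all: by case: (D q); case: (D p); rewrite /= ?orbF. }
- by rewrite sE /blocks (negPf Dx) (negPf Dy) !eqxx nyx.
- by rewrite tE /blocks (negPf Dx) (negPf Dy) !eqxx nxy.
- by move=> nPyx; apply: (blocks_linear_extension iD nPyx sE).
by move=> nPxy; apply: (blocks_linear_extension (ideal_atC iD) nPxy tE).
Qed.

(** Both orders of [x] and [y] give linear extensions, hence congruent ones. *)
Lemma incomparable_contracted (D : pred 'I_n) (x y : 'I_n) :
  x < y -> ~~ P x y -> ~~ P y x -> ideal_at D x y ->
  exists a : arc n, [/\ arc_lo a = x, arc_hi a = y,
    forall k : 'I_n, (k \in arc_A a) = (x < k < y) && D k & a \notin arcs_of R].
Proof.
move=> xy nxy nyx iD; have [a [s [t [al ah aA st [_ _ sP tP]]]]] := adjacent_extensions xy iD.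
exists a; split=> //; apply/(swapped_contracted Rc st).
by apply: linear_extensions_congruent; [apply: sP|apply: tP].
Qed.

Definition up_contracted (c d : 'I_n) := exists b : arc n,
  [/\ arc_lo b = c, arc_hi b = d, up_arc b & b \notin arcs_of R].

Definition down_contracted (c d : 'I_n) := exists b : arc n,
  [/\ arc_lo b = c, arc_hi b = d, down_arc b & b \notin arcs_of R].

(** Simplicity provides an up or a down subarc; since it is a subarc, its interior
    is on the side prescribed by [D]. *)
Lemma incomparable_split (D : pred 'I_n) (x y : 'I_n) :
  x < y -> ~~ P x y -> ~~ P y x -> ideal_at D x y ->
  exists c d : 'I_n, [/\ x <= c, c < d, d <= y &
    (up_contracted c d /\ forall k : 'I_n, c < k < d -> D k) \/
    (down_contracted c d /\ forall k : 'I_n, c < k < d -> ~~ D k)].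
Proof.
move=> xy nxy nyx iD; have [a [al ah aA aR]] := incomparable_contracted xy nxy nyx iD.
have [b [/and4P[lab hba /subsetP bA /subsetP bB] bR ud]] := minimal_contracted_subarc Rs aR.
exists (arc_lo b), (arc_hi b); split; rewrite ?arc_lo_hi -?al -?ah //.
case/orP: ud => ud; [left|right]; (split; first by exists b).
  move: ud => /andP[/eqP bE _] k ck; have : k \in arc_A a by apply: bA; rewrite bE inE.
  by rewrite aA => /andP[].
move: ud => /andP[_ /eqP bE] k ck; have : k \in arc_B a by apply: bB; rewrite bE inE.
by rewrite arc_AnB aA al ah => /andP[->].
Qed.

(** Otherwise exchanging [u] and [v], adjacent right after [D], would give a
    congruent permutation, hence a linear extension, contradicting [P u v]. *)
Lemma cover_uncontracted (D : pred 'I_n) (u v : 'I_n) (b : arc n) : hasse P u v ->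
  ideal_at D u v -> within (arc_lo b) (arc_hi b) u v -> b \notin arcs_of R ->
  (forall k, k \in arc_A b -> D k) -> (forall k, k \in arc_B b -> ~~ D k) -> False.
Proof.
move=> uv iD wi bR bA bB; have [Puv nuv nPvu _] := hasseP Pp uv.
have sub (a : arc n) : arc_lo a <= arc_lo b -> arc_hi b <= arc_hi a ->
    (forall k : 'I_n, (k \in arc_A a) = (arc_lo a < k < arc_hi a) && D k) -> a \notin arcs_of R.
  move=> lab hba aA; apply: (subarc_contracted Rc _ bR); rewrite /subarc lab hba /=.
  apply/andP; split; apply/subsetP => k kb; rewrite ?arc_AnB aA.
    by have := arc_A_sub kb; rewrite bA // => /andP[/(leq_ltn_trans lab)-> /leq_trans/(_ hba)->].
  have := arc_B_sub kb; rewrite (negPf (bB k kb)) andbF.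
  by case/andP=> [/(leq_ltn_trans lab)-> /leq_trans/(_ hba)->].
have [luv|lvu|/val_inj e] := ltngtP u v; last by rewrite e eqxx in nuv.
  have [a [s [t [al ah aA st [_ tvu sP _]]]]] := adjacent_extensions luv iD.
  have aR : a \notin arcs_of R.
    apply: sub; rewrite ?al ?ah //; move: wi luv (arc_lo_hi b); rewrite /within; clear; lia.
  have /(swapped_contracted Rc st) Rst := aR.
  have := congruent_linear_extension Rst (sP nPvu) Puv.
  by rewrite leqNgt -/(before t v u) tvu.
have [a [s [t [al ah aA st [svu _ _ tP]]]]] := adjacent_extensions lvu (ideal_atC iD).
have aR : a \notin arcs_of R.
  apply: sub; rewrite ?al ?ah //; move: wi lvu (arc_lo_hi b); rewrite /within; clear; lia.
have /(swapped_contracted Rc st) Rst := aR.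
have := congruent_linear_extension (cong_sym Rc Rst) (tP nPvu) Puv.
by rewrite leqNgt -/(before s v u) svu.
Qed.

Lemma ideal_below (x y : 'I_n) : ~~ P x y -> ~~ P y x ->
  ideal_at (fun k => [&& P k x || P k y, k != x & k != y]) x y.
Proof.
move=> nxy nyx; split; rewrite ?eqxx ?andbF //; last first.
  by move=> k kxy; rewrite kxy; case: (k == x); case: (k == y).
move=> k l kl /and3P[lxy nlx nly]; apply/and3P; split.
- by case/orP: lxy => [/(Pt kl)->|/(Pt kl)->]; rewrite ?orbT.
- apply: contraNneq nxy => kx; rewrite kx in kl; case/orP: lxy => [lx|ly].
    by move: nlx; rewrite (@Pa l x) ?eqxx // lx kl.
  exact: Pt ly.
- apply: contraNneq nyx => kx; rewrite kx in kl; case/orP: lxy => [lx|ly].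
    exact: Pt lx.
  by move: nly; rewrite (@Pa l y) ?eqxx // ly kl.
Qed.

(** Essentiality says that the arc from [a] to [a+1] is not contracted. *)
Lemma consecutive_comparable (a b : 'I_n) : b = a.+1 :> nat -> P a b || P b a.
Proof.
move=> ab; have lab : a < b by rewrite ab.
case Pab : (P a b) => //=; apply/negPn/negP => nba; move/negbT: Pab => nab.
have [g [gl gh _ gR]] := incomparable_contracted lab nab nba (ideal_below nab nba).
have empty k : (arc_lo g < k < arc_hi g) = false by rewrite gl gh ab; clear; lia.
case/negP: gR; apply: Re; first by rewrite gl gh.
  by apply/setP => k; rewrite inE; apply/negP => /arc_A_sub; rewrite empty.
by apply/setP => k; rewrite inE; apply/negP => /arc_B_sub; rewrite empty.
Qed.

Lemma ideal_not_above (x y : 'I_n) : ~~ P x y -> ~~ P y x ->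
  ideal_at (fun k => ~~ (P x k || P y k)) x y.
Proof.
move=> nxy nyx; split; rewrite ?Pr ?orbT //.
  move=> k l kl; apply: contra => /orP[xk|yk].
    by rewrite (Pt xk kl).
  by rewrite (Pt yk kl) orbT.
move=> k kxy; have [//|kx] := eqVneq k x; have [//|ky] := eqVneq k y.
rewrite /=; apply/negP => xyk; case/orP: kxy => kz; case/orP: xyk => zk.
- by move: kx; rewrite (@Pa k x) ?eqxx // kz zk.
- by rewrite (Pt zk kz) in nyx.
- by rewrite (Pt zk kz) in nxy.
- by move: ky; rewrite (@Pa k y) ?eqxx // kz zk.
Qed.

Lemma congruence_wall_system : wall_system P up_contracted down_contracted.
Proof.
split=> //.
- exact: consecutive_comparable.
- move=> u v c d uv [b [bl bh /andP[/eqP bA /eqP bB] bR]] wi.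
  have [Puv nuv nPvu cov] := hasseP Pp uv.
  case: (boolP [exists k : 'I_n, (c < k < d) && P u k]) => [/existsP[k /andP[]]|].
    by exists k.
  rewrite negb_exists => /forallP no.
  have noP (k : 'I_n) : c < k < d -> ~~ P u k by move=> ck; have := no k; rewrite ck.
  have kuv (k : 'I_n) : c < k < d -> k != u /\ k != v.
    move=> ck; move: wi ck; rewrite /within -!val_eqE /=; clear; lia.
  (* The least down-set listing the interior of the arc before [u] and [v]. *)
  pose D k := [&& [|| P k u, P k v | [exists l : 'I_n, (c < l < d) && P k l]], k != u & k != v].
  exfalso; apply: (@cover_uncontracted D u v b uv); rewrite ?bl ?bh //.
  + split; rewrite /D ?eqxx ?andbF //; last first.
      by move=> k; case: (P k u); case: (P k v); case: (k == u); case: (k == v).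
    move=> k l kl /and3P[lD lu lv]; apply/and3P; split.
    * case/or3P: lD => [/(Pt kl)->//|/(Pt kl)->|/existsP[m /andP[cm lm]]]; rewrite ?orbT //.
      by apply/or3P/Or33/existsP; exists m; rewrite cm (Pt kl lm).
    * apply/eqP => ku; rewrite ku in kl; case/or3P: lD => [lu'|lv'|/existsP[m /andP[cm lm]]].
      - by move: lu; rewrite (@Pa l u) ?eqxx // lu' kl.
      - by have [e|e] := cov _ kl lv'; rewrite e eqxx in lu lv.
      - by have := noP m cm; rewrite (Pt kl lm).
    * apply/eqP => kv; rewrite kv in kl; case/or3P: lD => [lu'|lv'|/existsP[m /andP[cm lm]]].
      - by rewrite (Pt kl lu') in nPvu.
      - by move: lv; rewrite (@Pa l v) ?eqxx // lv' kl.
      - by have := noP m cm; rewrite (Pt Puv (Pt kl lm)).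
  + move=> k; rewrite bA bl bh inE => ck; have [ku kv] := kuv k ck; apply/and3P; split=> //.
    by apply/or3P/Or33/existsP; exists k; rewrite ck Pr.
  + by move=> k; rewrite bB inE.
- move=> u v c d uv [b [bl bh /andP[/eqP bA /eqP bB] bR]] wi.
  have [Puv nuv nPvu cov] := hasseP Pp uv.
  case: (boolP [exists k : 'I_n, (c < k < d) && P k v]) => [/existsP[k /andP[]]|].
    by exists k.
  rewrite negb_exists => /forallP no.
  have noP (k : 'I_n) : c < k < d -> ~~ P k v by move=> ck; have := no k; rewrite ck.
  (* The greatest down-set leaving the interior of the arc after [u] and [v]. *)
  pose D k := ~~ [|| P u k, P v k | [exists l : 'I_n, (c < l < d) && P l k]].
  exfalso; apply: (@cover_uncontracted D u v b uv); rewrite ?bl ?bh //.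
  + split; rewrite /D ?Pr ?orbT //.
      move=> k l kl; apply: contra => /or3P[uk|vk|/existsP[m /andP[cm mk]]].
      - by rewrite (Pt uk kl).
      - by rewrite (Pt vk kl) orbT.
      - by apply/or3P/Or33/existsP; exists m; rewrite cm (Pt mk kl).
    move=> k kuv; have kv : P k v by case/orP: kuv => // /Pt; apply.
    have [//|ku] := eqVneq k u; have [//|nkv] := eqVneq k v.
    rewrite /=; apply/negP => /or3P[uk|vk|/existsP[m /andP[cm mk]]].
    - by have [e|e] := cov _ uk kv; rewrite e eqxx in ku nkv.
    - by move: nkv; rewrite (@Pa k v) ?eqxx // kv vk.
    - by have := noP m cm; rewrite (Pt mk kv).
  + by move=> k; rewrite bA inE.
  + move=> k; rewrite bB bl bh inE => ck; rewrite /D negbK.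
    by apply/or3P/Or33/existsP; exists k; rewrite ck Pr.
- move=> x y xy nxy nyx.
  have [c [d [xc cd dy alt]]] := incomparable_split xy nxy nyx (ideal_below nxy nyx).
  exists c, d; split=> //; case: alt => -[C Ck]; [left|right]; split=> // k ck.
    by have /and3P[] := Ck k ck.
  have := Ck k ck; have [kx ky] : k != x /\ k != y.
    by move: ck xc dy; rewrite -!val_eqE /=; clear; lia.
  by rewrite kx ky !andbT.
move=> x y xy nxy nyx.
have [c [d [xc cd dy alt]]] := incomparable_split xy nxy nyx (ideal_not_above nxy nyx).
exists c, d; split=> //; case: alt => -[C Ck]; [right|left]; split=> // k ck.
by have := Ck k ck; rewrite negbK.
Qed.

End CongruencePoset.

Theorem proposition3p12 (n : nat) (R : rel 'S_n) (P : rel 'I_n) :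
  1 <= n ->
  lattice_congruence R ->
  simple_congruence R ->
  essential R ->
  congruence_poset R P ->
  separating_tree (hasse P).
Proof.
move=> n1 Rc Rs Re [Pp [s RP]].
exact: wall_system_separating_tree n1 (congruence_wall_system Rc Rs Re Pp RP).
Qed.
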